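(* Let $K$ be a knot with a connected oriented diagram and Tait graph $G$, and let $\mathfrak T_o$ be an orientation preserving tree of $G$ (with the corresponding edge order). Then Rasmussen's $s$-invariant satisfies $$s(K)\ \ge\ j(\mathfrak T_o^{+})-1 .$$
   Context: **Tait graph.** The diagram has orientation $o$, is checkerboard coloured, has $n_+$ positive and $n_-$ negative crossings, and has a dot (marked point) on a fixed arc. The Tait graph $G$ is the plane graph with one vertex per black region and one edge per crossing, joining the black regions meeting there. An edge is positive if the $A$-smoothing of its crossing joins the two black regions, negative if it separates them. **Orientation preserving tree.** Colour an edge of $G$ red if the oriented resolution at its crossing joins the two black regions there, and black otherwise. Let $H_1$ be the subgraph of all red edges. In each component of $H_1$ remove positive red edges, keeping the component connected, until no more can be removed, and then negative red edges likewise, until each component is a tree; call the result $H_2$. Let $H_3$ be the spanning subgraph consisting of $H_2$ and all black edges. Remove positive black edges from $H_3$, keeping it connected, until no more can be removed, and then negative black edges likewise, until a spanning tree $H_4=\mathfrak T_o$ is obtained. The edges of $G$ are totally ordered so that $\{\text{red edges not in }H_4\}<\{\text{black edges in }H_4\}<\{\text{red edges in }H_4\}<\{\text{black edges not in }H_4\}$. **Activities.** Let $T$ be a spanning tree. For $e\in T$, $cut(T,e)$ is the set of edges of $G$ reconnecting $T\setminus e$; for $e\notin T$, $cyc(T,e)$ is the edge set of the unique cycle in $T\cup e$. An edge $e\in T$ is internally live if it is the smallest element of $cut(T,e)$, else internally dead; $e\notin T$ is externally live if it is the smallest element of $cyc(T,e)$, else externally dead. The activity letter of a positive edge is $L,D,l,d$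 if it is internally live, internally dead, externally live, externally dead respectively; for negative edges the letters are $\bar L,\bar D,\bar l,\bar d$. **Gradings.** For a spanning subgraph $H\subseteq G$, $F(H)$ is the disjoint union, over connected components $C$ of $H$, of the sets of faces of the plane graph $C$ (equivalently the boundary circles of a regular neighbourhood of $H$). For $\epsilon:F(H)\to\{1,x\}$ put $i(H,\epsilon)=\#\{\text{positive edges}\notin H\}+\#\{\text{negative edges}\in H\}-n_-$ and $j(H,\epsilon)=i(H,\epsilon)+|\epsilon^{-1}(1)|-|\epsilon^{-1}(x)|+n_+-n_-$. For a spanning tree $T$ let $H_c(T)$ consist of the internally dead and the externally live edges of $T$. Let $G(T)$ be the tree with vertex set $F(H_c(T))$ whose edges are the live edges of $T$, each joining the two faces that merge when that edge is added to or removed from $H_c(T)$; its root $v_d$ is the face whose circle contains the dot. The enhanced spanning subgraph $S_c^{T^+}=(H_c(T),\epsilon_c)$ has $\epsilon_c(v_d)=1$ and, for $v\neq v_d$, $\epsilon_c(v)=1$ if the edge of $G(T)$ from $v$ towards $v_d$ has letter $L$ or $\bar l$, and $\epsilon_c(v)=x$ if it has letter $\bar L$ or $l$. Finally $j(T^+)=j(S_c^{T^+})$. **$s$-invariant.** $s(K)=s_{\max}(K)-1=s_{\min}(K)+1$, where $s_{\max},s_{\min}$ are the $j$-gradings of the two copies of $\mathbb Q$ surviving in the Lee spectral sequence of $K$. *)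

(* Defs.v *)
From HB Require Import structures.
From mathcomp Require Import all_boot all_order all_algebra.

Set Implicit Arguments.
Unset Strict Implicit.
Unset Printing Implicit Defensive.

Import Order.TTheory GRing.Theory Num.Theory.
Local Open Scope ring_scope.

(* Link diagrams are combinatorial maps on the sphere.  The underlying plane
   graph has n 4-valent vertices (the crossings) and one 2-valent vertex (the
   dot), so that the crossingless diagram of the unknot is the case n = 0.  A
   dart is a half-edge seen from its vertex.  The darts (c, 0), (c, 1), (c, 2),
   (c, 3) of a crossing c are in counterclockwise order; (c, 0) and (c, 2) form
   the under-strand, (c, 1) and (c, 3) the over-strand. *)
Definition dart (n : nat) : finType := (('I_n * 'I_4) + bool)%type.

Definition crossing_dart (n : nat) (c : 'I_n) (k : 'I_4) : dart n := inl (c, k).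
Definition dot_dart (n : nat) (b : bool) : dart n := inr b.

Definition ccw (n : nat) (d : dart n) : dart n :=
  match d with
  | inl (c, k) => crossing_dart c (k + 1)
  | inr b => dot_dart n (~~ b)
  end.

Definition cw (n : nat) (d : dart n) : dart n :=
  match d with
  | inl (c, k) => crossing_dart c (k - 1)
  | inr b => dot_dart n (~~ b)
  end.

(* The opposite dart on the same strand. *)
Definition across (n : nat) (d : dart n) : dart n := ccw (if d is inl _ then ccw d else d).

(* The orbit of d under this map is the region on the left of d when d is
   traversed away from its vertex, that is, the region containing the corner
   between d and ccw d. *)
Definition face_step (n : nat) (arc : dart n -> dart n) (d : dart n) : dart n :=
  cw (arc d).

Record diagram (n : nat) := Diagram {
  arc : dart n -> dart n;      (* the other half of the arc of a dart *)
  outgoing : pred (dart n);    (* the orientation points away from the vertex *)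
  black : pred (dart n);       (* the region on the left of the dart is black *)
  arcK : involutive arc;
  arc_neq : forall d, arc d != d;
  diagram_connected :
    forall d d', connect [rel x y | (y == arc x) || (y == ccw x)] d d';
  (* Euler's formula #vertices + #regions = #arcs + 2 *)
  diagram_planar :
    (fcard (@ccw n) (dart n) + fcard (face_step arc) (dart n)
      = fcard arc (dart n) + 2)%N;
  outgoing_arc : forall d, outgoing (arc d) = ~~ outgoing d;
  outgoing_across : forall d, outgoing (across d) = ~~ outgoing d;
  black_region : forall d, black (face_step arc d) = black d;
  black_arc : forall d, black (arc d) = ~~ black d
}.

Definition is_knot (n : nat) (D : diagram n) : Prop :=
  forall d d', connect [rel x y | (y == arc D x) || (y == across x)] d d'.

Section Crossings.
Variables (n : nat) (D : diagram n).

(* With the under-strand directed from (c, 0) to (c, 2), the crossing is positive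
   when the over-strand passes from left to right, from (c, 3) to (c, 1). *)
Definition positive_crossing (c : 'I_n) : bool :=
  outgoing D (crossing_dart c 1) == outgoing D (crossing_dart c 2).

Definition n_pos : nat := #|[set c | positive_crossing c]|.
Definition n_neg : nat := #|[set c | ~~ positive_crossing c]|.

Inductive smoothing := SmA | SmB.

(* The regions swept by turning the over-strand counterclockwise are the
   corners following (c, 1) and (c, 3); the A-smoothing joins them. *)
Definition joins_black (s : smoothing) (c : 'I_n) : bool :=
  black D (crossing_dart c (if s is SmA then 1 else 0)).

Definition oriented_smoothing (c : 'I_n) : smoothing :=
  if positive_crossing c then SmA else SmB.

(* A Kauffman state is the set S of its B-smoothed crossings.  A-smoothing
   pairs the darts 0-1 and 2-3, B-smoothing pairs 1-2 and 3-0. *)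
Definition partner (S : {set 'I_n}) (d : dart n) : dart n :=
  match d with
  | inl (c, k) =>
      crossing_dart c (if odd k (+) (c \in S) then k - 1 else k + 1)
  | inr b => dot_dart n (~~ b)
  end.

Definition circle (S : {set 'I_n}) (d : dart n) : {set dart n} :=
  [set d' | connect [rel x y | (y == arc D x) || (y == partner S x)] d d'].

Definition circles (S : {set 'I_n}) : {set {set dart n}} :=
  [set circle S d | d in dart n].

(* An enhancement of S is given by the set X of the circles labelled x. *)
Definition j_grading (S : {set 'I_n}) (X : {set {set dart n}}) : int :=
  let i := #|S|%:Z - n_neg%:Z in
  i + #|circles S :\: X|%:Z - #|X|%:Z + n_pos%:Z - n_neg%:Z.

End Crossings.

Section Multigraph.
(* The edge e has ends u and v if joins e u v; the vertex set is gV. *)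
Variables (V E : finType) (gV : {set V}) (joins : E -> rel V).

Definition linked (H : {set E}) : rel V :=
  connect [rel u v | [exists e in H, joins e u v]].

Definition spanning_connected (H : {set E}) : bool :=
  [forall u in gV, forall v in gV, linked H u v].

(* A loop counts twice. *)
Definition degree (C : {set E}) (v : V) : nat :=
  \sum_(e in C) ([exists w, joins e v w] + joins e v v)%N.

Definition is_cycle (C : {set E}) : bool :=
  [&& C != set0,
      [forall v, (degree C v == 0) || (degree C v == 2)] &
      [forall u, forall v,
         (degree C u != 0) && (degree C v != 0) ==> linked C u v]].

Definition cut (T : {set E}) (e : E) : {set E} :=
  [set f | spanning_connected (f |: T :\ e)].

Definition cyc (T : {set E}) (e : E) : {set E} :=
  [set f | [exists C : {set E}, [&& is_cycle C, C \subset e |: T & f \in C]]].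

(* Removal of one edge in P that does not disconnect any component. *)
Definition prune_step (P : {set E}) (H H' : {set E}) : bool :=
  [exists e in H :&: P, (H' == H :\ e) &&
     [forall u, forall v, linked H' u v == linked H u v]].

(* H' is obtained from H by such removals, and no more are possible. *)
Definition pruned (P : {set E}) (H H' : {set E}) : bool :=
  connect (prune_step P) H H' && [forall K, ~~ prune_step P H' K].

End Multigraph.

Section TaitGraph.
Variables (n : nat) (D : diagram n).

Definition region (d : dart n) : {set dart n} :=
  [set d' | fconnect (face_step (arc D)) d d'].

Definition tait_vertices : {set {set dart n}} :=
  [set region d | d in black D].

(* The edge at a crossing c joins the regions of its two opposite black
   corners. *)
Definition tait_joins (c : 'I_n) (u v : {set dart n}) : bool :=
  [exists k : 'I_4, [&& black D (crossing_dart c k),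
     u == region (crossing_dart c k) & v == region (crossing_dart c (k + 2%:R))]].

Definition positive_edges : {set 'I_n} := [set c | joins_black D SmA c].
Definition negative_edges : {set 'I_n} := ~: positive_edges.

Definition red_edges : {set 'I_n} :=
  [set c | joins_black D (oriented_smoothing D c) c].
Definition black_edges : {set 'I_n} := ~: red_edges.

Definition orientation_preserving_tree (T : {set 'I_n}) : Prop :=
  exists H1' H2 H3' : {set 'I_n},
    [/\ pruned tait_joins positive_edges red_edges H1',
        pruned tait_joins negative_edges H1' H2,
        pruned tait_joins (positive_edges :&: black_edges)
          (H2 :|: black_edges) H3' &
        pruned tait_joins (negative_edges :&: black_edges) H3' T].

Definition edge_class (T : {set 'I_n}) (e : 'I_n) : nat :=
  match e \in red_edges, e \in T with
  | true, false => 0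
  | false, true => 1
  | true, true => 2
  | false, false => 3
  end.

Definition orientation_preserving_order (T : {set 'I_n}) (le : rel 'I_n) : Prop :=
  [/\ antisymmetric le, transitive le, total le &
      forall e f, (edge_class T e < edge_class T f)%N -> le e f].

(* The state whose circles bound a regular neighbourhood of the spanning
   subgraph H.  Each circle corresponds to one face of one component of H. *)
Definition state_of (H : {set 'I_n}) : {set 'I_n} :=
  (positive_edges :\: H) :|: (negative_edges :&: H).

Definition faces (H : {set 'I_n}) : {set {set dart n}} := circles D (state_of H).

Variables (T : {set 'I_n}) (le : rel 'I_n).

Definition internally_live (e : 'I_n) : bool :=
  (e \in T) && [forall f in cut tait_vertices tait_joins T e, le e f].

Definition externally_live (e : 'I_n) : bool :=
  (e \notin T) && [forall f in cyc tait_joins T e, le e f].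

Definition live_edges : {set 'I_n} :=
  [set e | internally_live e || externally_live e].

Definition Hc : {set 'I_n} :=
  [set e | (e \in T) && ~~ internally_live e || externally_live e].

(* In G(T) the edge e joins the two faces v, w that merge when e is added to,
   or removed from, Hc. *)
Definition GT_joins (e : 'I_n) (v w : {set dart n}) : bool :=
  let Hc' := if e \in Hc then Hc :\ e else e |: Hc in
  [&& v \in faces Hc, w \in faces Hc, v != w & v :|: w \in faces Hc'].

Definition GT_root : {set dart n} := circle D (state_of Hc) (dot_dart n true).

(* e is the first edge on the way from v to the root in G(T). *)
Definition towards_root (v : {set dart n}) (e : 'I_n) : bool :=
  (e \in live_edges) &&
  [exists w, GT_joins e v w && linked GT_joins (live_edges :\ e) w GT_root].

Definition letter_Lbar (e : 'I_n) : bool :=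
  internally_live e && (e \in negative_edges).
Definition letter_l (e : 'I_n) : bool :=
  externally_live e && (e \in positive_edges).

(* The faces to which epsilon_c assigns x; it assigns 1 to all others, because
   G(T) is a tree and each v != GT_root has exactly one edge towards the root. *)
Definition eps_c_x : {set {set dart n}} :=
  [set v in faces Hc | (v != GT_root) &&
     [exists e, towards_root v e && (letter_Lbar e || letter_l e)]].

Definition j_plus : int := j_grading D (state_of Hc) eps_c_x.

End TaitGraph.

Section Lee.
Variables (n : nat) (D : diagram n).

Definition enhanced_state : finType :=
  {e : {set 'I_n} * {set {set dart n}} | e.2 \subset circles D e.1}.

Definition j_state (e : enhanced_state) : int :=
  j_grading D (val e).1 (val e).2.

(* Lee's structure maps, on the number p of x labels before and q after:
   m(1,1) = 1, m(1,x) = x, m(x,x) = 1 and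
   Delta(1) = 1*x + x*1, Delta(x) = x*x + 1*1. *)
Definition merge_coef (p q : nat) : bool := (p, q) \in [:: (0, 0); (1, 1); (2, 0)]%N.
Definition split_coef (p q : nat) : bool := (p, q) \in [:: (0, 1); (1, 0); (1, 2)]%N.

(* The matrix entry from e to e' of the edge map changing the smoothing of c
   from A to B.  A circle that avoids c is the same set of darts before and
   after the change. *)
Definition edge_coef (e e' : enhanced_state) (c : 'I_n) : bool :=
  let (S, X) := val e in
  let (S', X') := val e' in
  let old := circles D S :\: circles D S' in
  let new := circles D S' :\: circles D S in
  let p := #|X :&: old| in
  let q := #|X' :&: new| in
  [&& c \notin S, S' == c |: S, X :\: old == X' :\: new &
      if (#|new| < #|old|)%N then merge_coef p q else split_coef p q].

Definition lee_coef (e e' : enhanced_state) : rat :=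
  \sum_(c < n | edge_coef e e' c) (-1) ^+ #|[set c' in (val e).1 | (c' < c)%N]|.

(* Chains are row vectors on the basis of enhanced states and the differential
   is right multiplication by lee_mx. *)
Definition lee_mx : 'M[rat]_#|enhanced_state| :=
  \matrix_(a, b) lee_coef (enum_val a) (enum_val b).

Definition lee_filtration (j : int) : 'M[rat]_#|enhanced_state| :=
  diag_mx (\row_a ((j <= j_state (enum_val a))%R)%:R).

(* dim E_infinity^j, where
   E_infinity^j = (Z :&: F_j) / (Z :&: F_(j+1) + B :&: F_j)
   with Z the cycles and B the boundaries, summed over homological degrees. *)
Definition lee_Einf_dim (j : int) : nat :=
  (\rank (kermx lee_mx :&: lee_filtration j)%MS
   - \rank (kermx lee_mx :&: lee_filtration (j + 1)
            + lee_mx :&: lee_filtration j)%MS)%N.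

(* The j-gradings, with multiplicity and in increasing order, of the copies of
   Q that survive in the Lee spectral sequence. *)
Definition surviving_gradings : seq int :=
  flatten [seq nseq (lee_Einf_dim j) j
          | j <- sort <=%R (undup [seq j_state e | e : enhanced_state])].

Definition s_max : int := last 0 surviving_gradings.
Definition s_min : int := head 0 surviving_gradings.

(* For a knot this equals s_min + 1 (Rasmussen). *)
Definition s_invariant : int := s_max - 1.

End Lee.

(* Main.v *)
(* The red edges and the given order make every red edge outside the tree
   externally live, every black edge of the tree internally live and all other
   edges dead.  Hence [Hc] is the red subgraph, its state is the oriented state,
   and the edges of G(T) form a spanning tree of the Seifert graph.  Because of
   the order of pruning, this tree contains a spanning tree of every component
   of the subgraph of positive crossings, so [eps_c] labels at most one circle
   of each such component with 1.

   Let sigma be the colour of a Seifert circle that decides whether black lies to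
   its left or to its right; the two circles at any crossing have different
   colours.  In the tensor product over the components of positive crossings,
   take in each component Lee's generator for sigma minus the one for the
   opposite colouring.  Merging at a positive crossing kills this chain, so it is
   a cycle, and each component has at least one circle labelled 1 in all of its
   terms, so that its filtration degree is at least that of [eps_c].  The
   coefficient of Lee's generator for sigma is a functional that vanishes on all
   boundaries (a split produces equal colours) but not on the cycle.

   Planarity is used for one fact: the two circles at a crossing outside [H]
   differ iff the crossing joins two components of [H]. *)

From mathcomp Require Import all_boot all_order all_algebra all_fingroup.
From mathcomp Require Import zify.
Require Import Defs.

Set Implicit Arguments.
Unset Strict Implicit.
Unset Printing Implicit Defensive.

Import Order.TTheory GRing.Theory Num.Theory.

(** * Connectivity of multigraphs *)

(** The differential is studied through the functionals [coloring_form], which read off coefficients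
    in Lee's basis. A colouring is a function on darts, so that one colouring can be compatible with
    many states, and each edge map, transposed, multiplies such a functional by a scalar or kills
    it. That the cycle is closed and that the differential squares to zero then become statements
    about scalars. The square is needed because [lee_Einf_dim] subtracts ranks: the difference
    measures a quotient only if boundaries are cycles.

    A combinatorial map comes without drawn curves, so it has to be proved that changing one
    smoothing always merges two circles or splits one. The checkerboard colouring gives this: a
    circle is traced by its black darts alone, and changing a smoothing multiplies the resulting
    permutation by a transposition.

    Statements about the Tait graph pass to Seifert circles by comparing states: if two darts share
    a circle in some state, their Seifert circles are linked through the crossings where that state
    differs from the oriented one. *)

Lemma connect_preserves (T : finType) (e : rel T) (P : pred T) (x y : T) :
  (forall u v, P u -> e u v -> P v) -> connect e x y -> P x -> P y.
Proof.
move=> Pe /connectP[p e_p ->]; elim: p x e_p => //= z p IHp x /andP[exz e_p] Px.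
exact: IHp e_p (Pe _ _ Px exz).
Qed.

Lemma leq_card_imset_kernel (T U W : finType) (A : {set T}) (f : T -> U) (g : T -> W) :
  {in A &, forall x y, g x = g y -> f x = f y} -> #|f @: A| <= #|g @: A|.
Proof.
move=> gf; have [->|[x0 Ax0]] := set_0Vmem A; first by rewrite !imset0 !cards0.
pose h c := f (odflt x0 [pick x in A | g x == c]).
suff ->: f @: A = h @: (g @: A) by apply: leq_imset_card.
rewrite -imset_comp; apply: eq_in_imset => x Ax; rewrite /h /=.
by case: pickP => [y /andP[Ay /eqP gy]|/(_ x)]; [apply: gf | rewrite Ax eqxx].
Qed.

Lemma card_imset_kernel (T U W : finType) (A : {set T}) (f : T -> U) (g : T -> W) :
  {in A &, forall x y, f x = f y <-> g x = g y} -> #|f @: A| = #|g @: A|.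
Proof.
by move=> fg; apply/eqP; rewrite eqn_leq !leq_card_imset_kernel // => x y Ax Ay /fg; apply.
Qed.

Section Multigraph.
Variables (V E : finType) (joins : E -> rel V) (a b : E -> V).
Hypothesis joinsE : forall e u v,
  joins e u v = (u == a e) && (v == b e) || (u == b e) && (v == a e).
Implicit Types (H K F T : {set E}) (e f g : E) (u v w : V).

Lemma linked_sym H u v : linked joins H u v = linked joins H v u.
Proof.
apply: sym_connect_sym => {}u {}v /=; apply: eq_existsb => e.
by rewrite !joinsE orbC ![(u == _) && _]andbC.
Qed.

Lemma linked_refl H u : linked joins H u u.
Proof. exact: connect0. Qed.

Lemma linked_trans H : transitive (linked joins H).
Proof. exact: connect_trans. Qed.

Lemma linked_ends H e : e \in H -> linked joins H (a e) (b e).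
Proof. by move=> He; apply/connect1/existsP; exists e; rewrite He joinsE !eqxx. Qed.

Lemma linked_joins H e u v : e \in H -> joins e u v -> linked joins H u v.
Proof. by move=> He e_uv; apply/connect1/existsP; exists e; rewrite He. Qed.

Lemma linked_preserves H (P : pred V) u v :
  {in H, forall e, P (a e) = P (b e)} -> linked joins H u v -> P u -> P v.
Proof.
move=> PH; apply: connect_preserves => {u v}u v Pu /existsP[e /andP[He]].
by rewrite joinsE => /orP[] /andP[/eqP Du /eqP->]; [rewrite -PH -?Du | rewrite PH -?Du].
Qed.

Lemma linked_sub_rel H K u v :
  {in H, forall e, linked joins K (a e) (b e)} -> linked joins H u v -> linked joins K u v.
Proof.
move=> HK Huv; apply: (linked_preserves (P := linked joins K u) _ Huv (linked_refl _ _)).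
move=> e /HK Kab; apply/idP/idP => /linked_trans; apply=> //.
by rewrite linked_sym.
Qed.

Lemma linkedS H K u v : H \subset K -> linked joins H u v -> linked joins K u v.
Proof. by move/subsetP=> sHK; apply: linked_sub_rel => e /sHK/linked_ends. Qed.

Lemma linked_const (U : eqType) (h : V -> U) H u v :
  {in H, forall e, h (a e) = h (b e)} -> linked joins H u v -> h u = h v.
Proof.
move=> hH Huv; apply/eqP.
by apply: (linked_preserves (P := fun w => h u == h w) _ Huv) => // e /hH->.
Qed.

Lemma linked0 u v : linked joins set0 u v = (u == v).
Proof.
apply/idP/eqP => [Huv|->]; last exact: linked_refl.
by apply: (linked_const (h := id) _ Huv) => e; rewrite inE.
Qed.

Lemma linked_setU1 H g u v :
  linked joins (g |: H) u v =
  [|| linked joins H u v, linked joins H u (a g) && linked joins H (b g) v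
    | linked joins H u (b g) && linked joins H (a g) v].
Proof.
have sH : H \subset g |: H by apply: subsetU1.
have gK : linked joins (g |: H) (a g) (b g) by apply: linked_ends; rewrite setU11.
apply/idP/idP => [Kuv|]; last first.
  case/or3P=> [|/andP[ua bv]|/andP[ub av]]; first exact: linkedS.
    exact: linked_trans (linkedS sH ua) (linked_trans gK (linkedS sH bv)).
  rewrite linked_sym in gK.
  exact: linked_trans (linkedS sH ub) (linked_trans gK (linkedS sH av)).
pose P v := [|| linked joins H u v, linked joins H u (a g) && linked joins H (b g) v
    | linked joins H u (b g) && linked joins H (a g) v].
have Pu : P u by rewrite /P linked_refl.
apply: (linked_preserves (P := P) _ Kuv Pu) => e; rewrite 2!inE /P.
have rf := linked_refl H.
case/orP=> [/eqP->|/linked_ends He].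
  by rewrite !rf !andbT; do 2 case: (linked joins H u _); rewrite ?orbT.
have Hr w : linked joins H w (a e) = linked joins H w (b e).
  by apply/idP/idP=> /linked_trans; apply; rewrite // linked_sym.
by rewrite !Hr.
Qed.

Definition bridge K e : bool := ~~ linked joins (K :\ e) (a e) (b e).

Lemma bridgeS H K e : H \subset K -> bridge K e -> bridge H e.
Proof. by move=> sHK; apply/contra/linkedS/setSD. Qed.

(* A path between the ends of [g] through the bridge [f] would form with [g] a
   cycle through [f]. *)
Lemma linked_avoid_bridge K f g : bridge K f -> g \in K -> g != f ->
  forall H, H \subset K :\ g -> linked joins H (a g) (b g) ->
  linked joins (H :\ f) (a g) (b g).
Proof.
move=> brf Kg g'f H sHK Hg; have [Hf|nHf] := boolP (f \in H); last first.
  suff ->: H :\ f = H by [].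
  by apply/setDidPl; rewrite disjoint_sym disjoints1.
have sHf : H :\ f \subset K :\ f by apply: setSD (subset_trans sHK (subsetDl _ _)).
have gK : linked joins (K :\ f) (a g) (b g) by apply: linked_ends; rewrite !inE g'f.
rewrite -(setD1K Hf) linked_setU1 in Hg.
case/or3P: Hg => // /andP[] /(linkedS sHf) H1 /(linkedS sHf) H2.
  case/negP: brf; rewrite linked_sym in H1; rewrite linked_sym in H2.
  exact: linked_trans H1 (linked_trans gK H2).
case/negP: brf; rewrite linked_sym in gK.
exact: linked_trans H2 (linked_trans gK H1).
Qed.

(** Deletes the bridges in [F] one after the other. It serves to push a cycle of the tree into its
    red part, and to free a path of the tree from its positive black edges. *)
Lemma linked_avoid_bridges K F g : {in F, forall f, bridge K f} ->
  g \in K -> g \notin F -> linked joins (K :\ g) (a g) (b g) ->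
  linked joins ((K :\ g) :\: F) (a g) (b g).
Proof.
move=> brF Kg nFg Kg_ab.
suff HS (s : seq E) : {subset s <= F} -> linked joins (K :\ g :\: [set x in s]) (a g) (b g).
  by rewrite -[F]set_enum; apply: HS => f; rewrite mem_enum.
elim: s => [|f s IHs] sF; first by rewrite set_nil setD0.
have Ff : f \in F by apply: sF; rewrite mem_head.
have ->: K :\ g :\: [set x in f :: s] = (K :\ g :\: [set x in s]) :\ f.
  by apply/setP=> x; rewrite !inE; do ![case: eqP => //= _]; rewrite ?andbF.
apply: linked_avoid_bridge (brF f Ff) Kg _ _ _ _.
- by apply: contraNneq nFg => ->.
- exact: subsetDl.
by apply: IHs => x sx; rewrite sF // inE sx orbT.
Qed.

Lemma linked_setD1 H e u v : e \in H -> linked joins (H :\ e) (a e) (b e) ->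
  linked joins (H :\ e) u v = linked joins H u v.
Proof.
move=> He Hab; apply/idP/idP; first exact: linkedS (subsetDl _ _).
apply: linked_sub_rel => f Hf; have [->//|f'e] := eqVneq f e.
by apply: linked_ends; rewrite !inE f'e.
Qed.

(** These four facts hold whatever the order of removal, and nothing else about pruning is used. The
    last one holds because an edge of [P] whose ends stay linked without it could still be
    removed. *)
Lemma prunedP (P H H' : {set E}) : pruned joins P H H' ->
  [/\ H' \subset H, H :\: H' \subset P,
      forall u v, linked joins H' u v = linked joins H u v
    & forall e, e \in H' -> e \in P -> bridge H' e].
Proof.
case/andP=> HH' /forallP noprune; split.
- apply: (connect_preserves (P := fun K => K \subset H) _ HH' (subxx _)) => K1 K2 sK1.
  by case/existsP=> e /and3P[_ /eqP-> _]; apply: subset_trans (subsetDl _ _) sK1.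
- apply: (connect_preserves (P := fun K => H :\: K \subset P) _ HH') => [K1 K2 sK1|].
    case/existsP=> e /and3P[/setIP[_ Pe] /eqP-> _]; apply/subsetP=> f.
    rewrite !inE; have [->//|f'e /= Hf] := eqVneq f e.
    by apply: (subsetP sK1); rewrite inE.
  by rewrite setDv sub0set.
- pose Q K := [forall u, forall v, linked joins K u v == linked joins H u v].
  suff /forallP QH' : Q H' by move=> u v; have /forallP/(_ v)/eqP := QH' u.
  apply: (connect_preserves (P := Q) _ HH'); last first.
    by apply/forallP=> u; apply/forallP=> v.
  move=> K1 K2 /forallP QK1 /existsP[e /and3P[_ _ /forallP H12]].
  apply/forallP=> u; apply/forallP=> v; have /forallP/(_ v)/eqP <- := QK1 u.
  by have /forallP/(_ v) := H12 u.
move=> e H'e Pe; apply: contra (noprune (H' :\ e)) => H'ab.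
apply/existsP; exists e; rewrite inE H'e Pe eqxx /=.
by apply/forallP=> u; apply/forallP=> v; apply/eqP/linked_setD1.
Qed.

Lemma degreeE (C : {set E}) v :
  degree joins C v = \sum_(e in C) ((v == a e) + (v == b e)).
Proof.
apply: eq_bigr => e _; rewrite joinsE.
have ->: [exists w, joins e v w] = (v == a e) || (v == b e).
  apply/existsP/idP => [[w]|].
    by rewrite joinsE => /orP[] /andP[-> _]; rewrite ?orbT.
  by case/orP=> /eqP Dv; [exists (b e) | exists (a e)]; rewrite joinsE Dv !eqxx ?orbT.
by rewrite andbC orbb; case: (v == a e); case: (v == b e).
Qed.

Lemma degree_setU1 (C : {set E}) e v : e \notin C ->
  degree joins (e |: C) v = (v == a e) + (v == b e) + degree joins C v.
Proof. by move=> nCe; rewrite !degreeE big_setU1. Qed.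

Lemma joins_ends_eqb e x y v : joins e x y ->
  (v == a e) + (v == b e) = (v == x) + (v == y).
Proof. by rewrite joinsE => /orP[] /andP[/eqP-> /eqP->] //; rewrite addnC. Qed.

Lemma simple_path_edges H x p :
  path [rel u v | [exists e in H, joins e u v]] x p -> uniq (x :: p) -> p != [::] ->
  exists C : {set E}, [/\ C \subset H,
    forall v, degree joins C v =
      if v \in x :: p then (if (v == x) || (v == last x p) then 1 else 2) else 0
    & forall v, v \in x :: p -> linked joins C x v].
Proof.
elim: p x => //= y p IHp x /andP[/existsP[e /andP[He exy]] e_p] /andP[xNyp Uyp] _.
have x'y : x != y by apply: contraNneq xNyp => ->; apply: mem_head.
have [Dp|p_n0] := eqVneq p [::].
  subst p; exists [set e]; split; first by rewrite sub1set.
    move=> v; rewrite degreeE big_set1 (joins_ends_eqb _ exy) !inE /=.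
    have [->|_] := eqVneq v x; first by rewrite (negPf x'y).
    by case: (v == y).
  move=> v; rewrite !inE => /orP[] /eqP->; first exact: linked_refl.
  by apply: (linked_joins (e := e)); rewrite ?set11.
have [C [sCH degC linkC]] := IHp y e_p Uyp p_n0.
have nCe : e \notin C.
  apply/negP=> Ce; have := degC x; rewrite (negPf xNyp) degreeE (big_setD1 e) //=.
  by rewrite (joins_ends_eqb _ exy) eqxx.
exists (e |: C); split; first by rewrite subUset sub1set He.
  move=> v; rewrite degree_setU1 // (joins_ends_eqb _ exy) degC !inE.
  have [->|x'v] := eqVneq v x; first by move: xNyp; rewrite (negPf x'y) inE negb_or => /andP[_ /negPf->].
  have [->|y'v] //= := eqVneq v y.
  have yp : y \notin p by case/andP: Uyp.
  case: eqP => // yl; case/negP: yp.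
  case: (p) p_n0 yl => //= z q _ ->; exact: mem_last.
have sC : C \subset e |: C by apply: subsetUr.
move=> v; rewrite inE => /orP[/eqP->|/linkC yv]; first exact: linked_refl.
apply: linked_trans (linkedS sC yv).
by apply: (linked_joins (e := e)); rewrite ?setU11.
Qed.

(** A simple path has degree 1 at its ends and 2 in between, so [e] closes it to a cycle in the
    sense of [is_cycle]. *)
Lemma cycle_exists H e : e \notin H -> a e != b e -> linked joins H (a e) (b e) ->
  exists C : {set E}, [/\ is_cycle joins (e |: C), C \subset H & linked joins C (a e) (b e)].
Proof.
move=> nHe a'b /connectP[p0 e_p0 lst]; case/shortenP: e_p0 lst => p e_p Up _ lst.
have p_n0 : p != [::] by apply: contraNneq a'b => Dp; rewrite lst Dp.
have [C [sCH degC linkC]] := simple_path_edges e_p Up p_n0.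
have nCe : e \notin C by apply: contra nHe; apply: (subsetP sCH).
have pb : b e \in a e :: p by rewrite lst mem_last.
exists C; split=> //; last exact: linkC.
have degU v : degree joins (e |: C) v = if v \in a e :: p then 2 else 0.
  rewrite degree_setU1 // degC -lst.
  have [->|a'v] := eqVneq v (a e); first by rewrite mem_head (negPf a'b).
  by have [->|b'v] := eqVneq v (b e); rewrite ?pb //; case: ifP.
apply/and3P; split.
- by apply/set0Pn; exists e; apply: setU11.
- by apply/forallP=> v; rewrite degU; case: ifP.
apply/forallP=> u; apply/forallP=> v; apply/implyP; rewrite !degU.
have sC : C \subset e |: C by apply: subsetUr.
case: ifP => // up; case: ifP => // vp _.
apply: (linked_trans (y := a e)); last exact: linkedS (linkC v vp).
by rewrite linked_sym; apply: linkedS (linkC u up).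
Qed.

(** * Counting components *)

Definition component H v : {set V} := [set w | linked joins H v w].

Lemma component_eq H u v : (component H u == component H v) = linked joins H u v.
Proof.
apply/eqP/idP => [/setP/(_ v)|Huv]; first by rewrite !inE linked_refl.
apply/setP=> w; rewrite !inE; apply/idP/idP; last exact: linked_trans.
by apply: linked_trans; rewrite linked_sym.
Qed.

Definition num_components (gV : {set V}) H := #|component H @: gV|.

Lemma num_components_setU1_linked gV H g : linked joins H (a g) (b g) ->
  num_components gV (g |: H) = num_components gV H.
Proof.
move=> Hab; apply: card_imset_kernel => u v _ _.
suff Dlink : linked joins (g |: H) u v = linked joins H u v.
  by split=> /eqP Duv; apply/eqP; move: Duv; rewrite !component_eq Dlink.
apply/idP/idP; last exact: linkedS (subsetUr _ _).
apply: linked_sub_rel => f; rewrite !inE => /orP[/eqP->//|]; exact: linked_ends.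
Qed.

(** The components of [H] other than that of [b g] stay distinct in [g |: H], since the new edge can
    only attach something to the one left out. *)
Lemma num_components_setU1 gV H g :
  num_components gV H <= num_components gV (g |: H) + 1.
Proof.
rewrite /num_components (cardsD1 (component H (b g))) addnC leq_add ?leq_b1 //.
have ->: (component H @: gV) :\ component H (b g)
    = component H @: (gV :\: component H (b g)).
  apply/setP=> C; apply/setD1P/imsetP => [[C'b /imsetP[v gv DC]]|[v /setDP[gv bv] ->]].
    exists v => //; rewrite inE gv andbT inE.
    by rewrite -component_eq eq_sym -DC.
  by split; [rewrite eq_sym component_eq; rewrite inE in bv | apply: imset_f].
have sD : gV :\: component H (b g) \subset gV by apply: subsetDl.
apply: leq_trans (subset_leq_card (imsetS _ sD)).
apply: leq_card_imset_kernel => u v; rewrite !inE => /andP[bu _] /andP[bv _] /eqP.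
rewrite component_eq linked_setU1 => /or3P[||] //; first by rewrite -component_eq => /eqP.
  by case/andP=> _; rewrite (negPf bv).
by case/andP; rewrite linked_sym (negPf bu).
Qed.

Lemma num_components0 gV : num_components gV set0 = #|gV|.
Proof.
apply: card_in_imset => u v _ _ /eqP; rewrite component_eq linked0.
by move/eqP.
Qed.

Lemma num_components_connected gV H :
  spanning_connected gV joins H -> num_components gV H <= 1.
Proof.
move/forallP=> Hconn; have [->|[v0 gv0]] := set_0Vmem gV.
  by rewrite /num_components imset0 cards0.
rewrite -(cards1 (component H v0)); apply/subset_leq_card/subsetP=> _ /imsetP[v gv ->].
rewrite inE component_eq; have /implyP/(_ gv)/forallP/(_ v0)/implyP := Hconn v; exact.
Qed.

Lemma linked_path_avoiding H e u x q :
  path [rel u v | [exists e in H, joins e u v]] x q -> u \notin x :: q ->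
  (u == a e) || (u == b e) -> linked joins (H :\ e) x (last x q).
Proof.
move=> e_q + ue; elim: q x e_q => [|y q IHq] x /=; first by rewrite linked_refl.
case/andP=> /existsP[f /andP[Hf fxy]] e_q; rewrite inE negb_or => /andP[u'x uq].
apply: linked_trans (IHq y e_q uq); apply: (linked_joins (e := f)) => //.
rewrite !inE Hf andbT; apply: contraTneq ue => <-.
have u'y : u != y by move: uq; rewrite inE negb_or => /andP[].
by move: fxy; rewrite joinsE => /orP[] /andP[/eqP<- /eqP<-]; rewrite negb_or u'x u'y.
Qed.

(* The last vertex [r], in the class of [v], on a path from [v] to the root is
   the only one whose edge towards the root may leave [Lp]. *)
Lemma towards_root_class (L Lp : {set E}) (root v v' : V) :
  Lp \subset L -> linked joins L v root ->
  linked joins Lp v v' -> v != v' ->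
  exists u e w, [/\ (u == v) || (u == v'), u != root, e \in Lp, joins e u w
                  & linked joins (L :\ e) w root].
Proof.
move=> sLpL Lv_root Pvv' v'v.
(* Edges with both ends in the [Lp]-class of [v]. A path in [L'] from a vertex [r] of the class to
   the root uses none of them. *)
pose inside e := linked joins Lp v (a e) && linked joins Lp v (b e).
pose L' := [set e in L | ~~ inside e].
have [r0 [Pr0 L'r0]] : exists r, linked joins Lp v r /\ linked joins L' r root.
  pose Q u := linked joins L' u root || [exists r, linked joins Lp v r && linked joins L' r root].
  suff: Q v.
    case/orP=> [Lvr|/existsP[r /andP[]]]; last by exists r.
    by exists v; rewrite linked_refl.
  have Qroot : Q root by rewrite /Q linked_refl.
  rewrite linked_sym in Lv_root.
  apply: (linked_preserves (P := Q) _ Lv_root Qroot) => e Le; rewrite /Q.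
  case: existsP => [_|no_r]; rewrite ?orbT // !orbF.
  have [/andP[Pa Pb]|out] := boolP (inside e).
    by apply/idP/idP=> L'_root; case: no_r; [exists (a e) | exists (b e)]; apply/andP.
  have L'ab : linked joins L' (a e) (b e) by apply: linked_ends; rewrite inE Le.
  by apply/idP/idP; apply: linked_trans => //; rewrite linked_sym.
(* If the class contains the root, then [r] is taken to be the root; in both cases a vertex of the
   class other than [r] is not the root. *)
have [r [Pr L'r rootP]] : exists r, [/\ linked joins Lp v r, linked joins L' r root
                                   & (r == root) || ~~ linked joins Lp v root].
  have [Proot|nProot] := boolP (linked joins Lp v root); last by exists r0; rewrite orbT.
  by exists root; rewrite linked_refl eqxx.
have [u [u_vv' u'r Pvu]] : exists u, [/\ (u == v) || (u == v'), u != r & linked joins Lp v u].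
  have [Dr|] := eqVneq v r; last by exists v; rewrite eqxx linked_refl.
  by exists v'; rewrite eqxx orbT -Dr eq_sym v'v.
have root'u : u != root.
  case/orP: rootP => [/eqP<-//|]; by apply: contraNneq => <-.
have /connectP[p0 e_p0 lst] : linked joins Lp u r.
  by apply: linked_trans Pr; rewrite linked_sym.
(* The edge sought is the first one on a simple path from [u] to [r] within [Lp]: the rest of that
   path avoids [u], and the way on from [r] uses no inside edge. *)
case/shortenP: e_p0 lst => -[_ _ _ Dr|w p]; first by rewrite Dr eqxx in u'r.
rewrite [path _ _ _]/= => /andP[/existsP[e /andP[Pe euw]] e_p] /= /andP[uNp _] _ lst.
have ue : (u == a e) || (u == b e).
  by move: euw; rewrite joinsE => /orP[] /andP[-> _]; rewrite ?orbT.
exists u, e, w; split=> //; apply: (linked_trans (y := r)).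
  by rewrite lst; apply: linkedS (linked_path_avoiding e_p uNp ue); apply: setSD.
apply: linkedS L'r; apply/subsetP=> f; rewrite !inE => /andP[-> outf]; rewrite andbT.
apply: contraNneq outf => ->; rewrite /inside.
have Pvw : linked joins Lp v w by apply: linked_trans Pvu (linked_joins Pe euw).
by move: euw; rewrite joinsE => /orP[] /andP[/eqP <- /eqP <-]; rewrite Pvu Pvw.
Qed.

End Multigraph.

(** * Circles of a state as cycles of a permutation *)

Local Open Scope ring_scope.

Lemma ord4P (P : 'I_4 -> Prop) : P 0 -> P 1 -> P 2%:R -> P 3%:R -> forall k, P k.
Proof.
by move=> P0 P1 P2 P3 [[|[|[|[|//]]]] ?];
  [move: P0 | move: P1 | move: P2 | move: P3]; congr P; apply: val_inj.
Qed.

Lemma ord4_succ : ((0 : 'I_4) + 1 = 1) * ((1 : 'I_4) + 1 = 2%:R)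
  * ((2%:R : 'I_4) + 1 = 3%:R) * ((3%:R : 'I_4) + 1 = 0).
Proof. by do !split; apply: val_inj. Qed.

Lemma ord4_pred : ((0 : 'I_4) - 1 = 3%:R) * ((1 : 'I_4) - 1 = 0)
  * ((2%:R : 'I_4) - 1 = 1) * ((3%:R : 'I_4) - 1 = 2%:R).
Proof. by do !split; apply: val_inj. Qed.

Lemma ord4_add2 : ((0 : 'I_4) + 2%:R = 2%:R) * ((1 : 'I_4) + 2%:R = 3%:R)
  * ((2%:R : 'I_4) + 2%:R = 0) * ((3%:R : 'I_4) + 2%:R = 1).
Proof. by do !split; apply: val_inj. Qed.

Lemma ord4_add22 (k : 'I_4) : k + 2%:R + 2%:R = k.
Proof. by elim/ord4P: k; apply: val_inj. Qed.

Section Diagram.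
Variables (n : nat) (D : diagram n).
Implicit Types (S H : {set 'I_n}) (c : 'I_n) (d x y : dart n).

Lemma ccwK : cancel (@ccw n) (@cw n).
Proof. by case=> [[c k]|b] /=; rewrite ?addrK ?negbK. Qed.

Lemma cwK : cancel (@cw n) (@ccw n).
Proof. by case=> [[c k]|b] /=; rewrite ?subrK ?negbK. Qed.

Lemma black_cw d : black D (cw d) = ~~ black D d.
Proof. by have := black_region D (arc D d); rewrite /face_step arcK black_arc. Qed.

Lemma black_ccw d : black D (ccw d) = ~~ black D d.
Proof. by rewrite -[in RHS](ccwK d) black_cw negbK. Qed.

Lemma black_succ c k : black D (crossing_dart c (k + 1)) = ~~ black D (crossing_dart c k).
Proof. exact: (black_ccw (crossing_dart c k)). Qed.

Lemma black_corner_exists c : exists k, black D (crossing_dart c k).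
Proof.
have [b0|w0] := boolP (black D (crossing_dart c 0)); first by exists 0.
by exists (0 + 1); rewrite black_succ w0.
Qed.

Lemma black_opp c k : black D (crossing_dart c (k + 2%:R)) = black D (crossing_dart c k).
Proof.
by rewrite -[RHS]negbK -!black_ccw /= -addrA.
Qed.

Lemma partnerK S : involutive (partner S).
Proof.
case=> [[c k]|b] /=; last by rewrite negbK.
by congr (inl (c, _)); elim/ord4P: k; case: (c \in S); apply: val_inj.
Qed.

Lemma black_partner S d : black D (partner S d) = ~~ black D d.
Proof.
case: d => [[c k]|b]; last exact: (black_ccw (dot_dart n b)).
by rewrite /=; case: ifP => _; 
  [apply: (black_cw (crossing_dart c k)) | apply: (black_ccw (crossing_dart c k))].
Qed.

Lemma circle_sym S x y : (y \in circle D S x) = (x \in circle D S y).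
Proof.
rewrite !inE; apply: sym_connect_sym => u v /=.
by congr (_ || _); apply/eqP/eqP => ->; rewrite ?arcK ?partnerK.
Qed.

Lemma circle_refl S x : x \in circle D S x.
Proof. by rewrite inE connect0. Qed.

Lemma circle_eq S x y : (circle D S x == circle D S y) = (y \in circle D S x).
Proof.
apply/eqP/idP => [->|xy]; first exact: circle_refl.
apply/setP=> w; apply/idP/idP; rewrite ![w \in _]inE; apply: connect_trans.
  by rewrite circle_sym inE in xy.
by rewrite inE in xy.
Qed.

Lemma circle_eqP S x y : reflect (circle D S x = circle D S y) (y \in circle D S x).
Proof. by rewrite -circle_eq; apply: eqP. Qed.

Lemma circle_arc S x : circle D S (arc D x) = circle D S x.
Proof. by apply/esym/circle_eqP; rewrite inE connect1 //= eqxx. Qed.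

Lemma circle_partner S x : circle D S (partner S x) = circle D S x.
Proof. by apply/esym/circle_eqP; rewrite inE connect1 //= eqxx orbT. Qed.

Lemma circle_preserves S (P : pred (dart n)) x y :
  (forall d, P d -> P (arc D d)) -> (forall d, P d -> P (partner S d)) ->
  y \in circle D S x -> P x -> P y.
Proof.
move=> Parc Ppartner; rewrite inE.
by apply: connect_preserves => {x y}x y Px /orP[] /eqP->; [apply: Parc | apply: Ppartner].
Qed.

Lemma circle_const (U : eqType) S (h : dart n -> U) x y :
  (forall d, h (arc D d) = h d) -> (forall d, h (partner S d) = h d) ->
  y \in circle D S x -> h x = h y.
Proof.
move=> harc hpartner xy; apply/eqP.
by apply: (circle_preserves (P := fun d => h x == h d) _ _ xy) => // d; rewrite ?harc ?hpartner.
Qed.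

Lemma circle_in S x : circle D S x \in circles D S.
Proof. exact: imset_f. Qed.

Lemma circlesP S C : reflect (exists x, C = circle D S x) (C \in circles D S).
Proof.
by apply: (iffP imsetP) => [[x _]|[x]] ->; exists x.
Qed.

Lemma circle_of S C x : C \in circles D S -> x \in C -> C = circle D S x.
Proof. by case/circlesP=> y -> /circle_eqP. Qed.

Lemma imset_black_all (U : finType) (h : dart n -> U) (col : bool) :
  (forall d, h (arc D d) = h d) ->
  [set h d | d in dart n] = [set h d | d in [set d | black D d == col]].
Proof.
move=> harc; apply/setP=> C; apply/imsetP/imsetP => [[d _ ->]|[d _ ->]]; last by exists d.
have [Dd|d'] := eqVneq (black D d) col; first by exists d; rewrite // inE Dd.
exists (arc D d); rewrite ?harc // inE black_arc.
by case: (black D d) d'; case: col.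
Qed.

(** Since [arc] and [partner] both exchange the colours, their composite runs along a circle through
    its black darts. White darts are made fixed points to obtain a permutation of all darts. *)
Definition turn S d := if black D d then arc D (partner S d) else d.

Lemma black_turn S d : black D (turn S d) = black D d.
Proof.
by rewrite /turn; case bd: (black D d) => //; rewrite black_arc black_partner bd.
Qed.

Lemma turn_inj S : injective (turn S).
Proof.
move=> d d' Dd; have := congr1 (black D) Dd; rewrite !black_turn => Db.
move: Dd; rewrite /turn Db; case: ifP => // _ /(inv_inj (@arcK _ D)).
by move/(inv_inj (partnerK S)).
Qed.

Definition turn_perm S : {perm dart n} := perm (@turn_inj S).

Lemma porbit_turn S x y : black D x -> black D y ->
  (porbit (turn_perm S) x == porbit (turn_perm S) y) = (circle D S x == circle D S y).
Proof.
move=> bx by_; rewrite eq_porbit_mem circle_eq; apply/idP/idP.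
  rewrite porbit_sym => /porbitP[i ->]; elim: i => [|i IHi]; first by rewrite perm1 circle_refl.
  rewrite expgSr permM permE /turn; case: ifP => // _.
  by rewrite -circle_eq circle_arc circle_partner circle_eq.
pose h d := porbit (turn_perm S) (if black D d then d else arc D d).
have harc d : h (arc D d) = h d by rewrite /h black_arc arcK; case: (black D d).
have hturn d : black D d -> h (arc D (partner S d)) = h d.
  move=> bd; rewrite /h black_arc black_partner negbK bd.
  have ->: arc D (partner S d) = turn_perm S d by rewrite permE /turn bd.
  by have := porbit_perm (turn_perm S) 1 d; rewrite expg1.
have hpartner d : h (partner S d) = h d.
  have [bd|wd] := boolP (black D d); first by rewrite -[RHS]hturn // harc.
  have bp : black D (partner S d) by rewrite black_partner.
  by rewrite -[LHS]hturn // harc partnerK.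
move=> xy; have := circle_const harc hpartner xy.
by rewrite /h bx by_ -eq_porbit_mem => ->.
Qed.

(** The second summand counts the white darts, each of which is an orbit by itself. *)
Lemma card_porbits_turn S :
  #|porbits (turn_perm S)| = (#|circles D S| + #|[set d | ~~ black D d]|)%N.
Proof.
pose B := [set d : dart n | black D d].
have Dorb : porbits (turn_perm S)
  = porbit (turn_perm S) @: B :|: porbit (turn_perm S) @: ~: B.
  apply/setP=> C; rewrite /porbits -imsetU setUCr.
  by apply/imsetP/imsetP => [] [d _ ->]; exists d.
have black_orb x y : y \in porbit (turn_perm S) x -> black D y = black D x.
  case/porbitP=> i ->; elim: i => [|i IHi]; first by rewrite perm1.
  by rewrite expgSr permM permE black_turn.
rewrite Dorb cardsU -[RHS]subn0; congr (_ - _)%N; last first.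
  apply/eqP; rewrite cards_eq0; apply/eqP/setP=> C; rewrite !inE.
  apply/andP=> -[/imsetP[x Bx ->] /imsetP[y By /eqP]].
  rewrite eq_porbit_mem porbit_sym => /black_orb; rewrite !inE in Bx By.
  by rewrite (negPf By) Bx.
congr (_ + _)%N.
  have ->: circles D S = circle D S @: B.
    have ->: B = [set d | black D d == true] by apply/setP=> d; rewrite !inE eqb_id.
    exact: imset_black_all (circle_arc S).
  apply: card_imset_kernel => x y; rewrite !inE => bx by_.
  by split=> /eqP Dxy; apply/eqP; move: Dxy; rewrite porbit_turn.
have ->: [set d | ~~ black D d] = ~: B by apply/setP=> d; rewrite !inE.
apply: card_in_imset => x y; rewrite !inE => wx _ /eqP; rewrite eq_porbit_mem.
have fixw i : (turn_perm S ^+ i)%g y = y \/ black D y.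
  by have [|wy] := boolP (black D y); [right | left; apply: permX_fix; rewrite permE /turn (negPf wy)].
case/porbitP=> i Dx; case: (fixw i) => [Dy|bY]; first by rewrite Dx Dy.
by case/negP: wx; rewrite Dx (@black_orb y) ?mem_porbit.
Qed.

(* Changing the smoothing at [c] multiplies the permutation by the transposition
   of the two black darts at [c]. *)
Lemma turn_perm_flip S c k : c \notin S -> black D (crossing_dart c k) ->
  turn_perm (c |: S)
  = (tperm (crossing_dart c k) (crossing_dart c (k + 2%:R)) * turn_perm S)%g.
Proof.
move=> nSc bk; apply/permP=> d; rewrite permM [LHS]permE [RHS]permE /turn.
have bk2 := bk; rewrite -black_opp in bk2.
have par (m : 'I_4) : partner (c |: S) (crossing_dart c m) = partner S (crossing_dart c (m + 2%:R)).
  rewrite /= setU11 (negPf nSc); congr (inl (c, _)).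
  by elim/ord4P: m; apply: val_inj.
case: tpermP => [->|->|dk dk2].
- by rewrite bk bk2 par.
- rewrite bk bk2 par; congr (arc D (partner S (inl (c, _)))).
  by rewrite -addrA -natrD; elim/ord4P: (k); apply: val_inj.
case: ifP => // bd; congr (arc D _); case: d bd dk dk2 => // -[c' k'] bd dk dk2 /=.
have [Dc|c'c] := eqVneq c' c; last by rewrite !inE (negPf c'c).
subst c'; exfalso.
have [j Dj] : exists j, k' = k + j by exists (k' - k); rewrite addrC subrK.
subst k'; elim/ord4P: j dk dk2 bd => // dk dk2.
- by rewrite addr0 in dk.
- by rewrite black_succ bk.
by rewrite (natrD _ 2 1) addrA black_succ bk2.
Qed.

(** True when changing the smoothing at [c] merges two circles, false when it splits one. By
    [separatesE] any two opposite darts may be used. *)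
Definition separates S c :=
  circle D S (crossing_dart c 0) != circle D S (crossing_dart c 2%:R).

Lemma opp_inj c (k : 'I_4) : crossing_dart c k != crossing_dart c (k + 2%:R).
Proof. by apply/eqP=> -[]; elim/ord4P: k. Qed.

Lemma circle_opp_partner S c (k : 'I_4) :
  circle D S (crossing_dart c k) = circle D S (crossing_dart c (k + 1))
  /\ circle D S (crossing_dart c (k + 2%:R)) = circle D S (crossing_dart c (k + 3%:R))
  \/ circle D S (crossing_dart c k) = circle D S (crossing_dart c (k + 3%:R))
  /\ circle D S (crossing_dart c (k + 2%:R)) = circle D S (crossing_dart c (k + 1)).
Proof.
have par m := circle_partner S (crossing_dart c m).
have := par k; have := par (k + 2%:R); rewrite /=.
have Dk : (k + 2%:R - 1 = k + 1) * (k + 2%:R + 1 = k + 3%:R) * (k - 1 = k + 3%:R)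
           * (odd (k + 2%:R)%R = odd k) by elim/ord4P: k; do !split; apply: val_inj.
rewrite !Dk; case: ifP => _ -> ->; [right | left]; by [].
Qed.

Lemma separatesE S c k : separates S c =
  (circle D S (crossing_dart c k) != circle D S (crossing_dart c (k + 2%:R))).
Proof.
suff step (m : 'I_4) : (circle D S (crossing_dart c m) == circle D S (crossing_dart c (m + 2%:R)))
   = (circle D S (crossing_dart c (m + 1)) == circle D S (crossing_dart c (m + 3%:R))).
  have := step 0; rewrite !add0r /separates => step0; congr (~~ _).
  by elim/ord4P: k; rewrite ?ord4_add2 //; rewrite step0 eq_sym.
case: (circle_opp_partner S c m) => -[-> ->] //; exact: eq_sym.
Qed.

(** A transposition joins two cycles of a permutation or cuts one in two, so the number of circles
    always changes by exactly one. *)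
Lemma card_circles_setU1 S c : c \notin S ->
  (#|circles D (c |: S)| + (separates S c).*2 = #|circles D S| + 1)%N.
Proof.
move=> nSc; have [k bk] := black_corner_exists c.
have bk2 := bk; rewrite -black_opp in bk2.
have := porbits_mul_tperm (turn_perm S) (crossing_dart c k) (crossing_dart c (k + 2%:R)).
rewrite /= -turn_perm_flip // !card_porbits_turn opp_inj -eq_porbit_mem porbit_turn //.
rewrite (separatesE S c k) /=; lia.
Qed.

Lemma separates_setU1 S c : c \notin S -> separates (c |: S) c = ~~ separates S c.
Proof.
move=> nSc; have [k bk] := black_corner_exists c.
have bk2 := bk; rewrite -black_opp in bk2.
pose x := crossing_dart c k; pose y := crossing_dart c (k + 2%:R).
have Dt : turn_perm (c |: S) = (tperm x y * turn_perm S)%g := turn_perm_flip nSc bk.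
have Dt' : (tperm x y * turn_perm (c |: S))%g = turn_perm S by rewrite Dt mulgA tperm2 mul1g.
have := porbits_mul_tperm (turn_perm S) x y.
have := porbits_mul_tperm (turn_perm (c |: S)) x y.
rewrite /= Dt' -Dt opp_inj -!eq_porbit_mem !porbit_turn // !(separatesE _ c k) -/x -/y; lia.
Qed.

End Diagram.

(** * Changing the smoothing at one crossing *)

Section Flip.
Variables (n : nat) (D : diagram n).
Implicit Types (S H : {set 'I_n}) (c : 'I_n) (d x y : dart n).

(** A symmetric relation, so that a split is a merge read backwards and [circles_merge] covers
    both. *)
Definition flip_at c S S' := forall c', (c' \in S') = (c' == c) (+) (c' \in S).

Lemma flip_at_sym c S S' : flip_at c S S' -> flip_at c S' S.
Proof. by move=> flipc c'; rewrite flipc addbA addbb. Qed.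

Lemma flip_at_setU1 c S : c \notin S -> flip_at c S (c |: S).
Proof. by move=> nSc c'; rewrite !inE; case: eqVneq => // ->; rewrite (negPf nSc). Qed.

Lemma flip_at_setU1E c S S' : flip_at c S S' -> c \notin S -> S' = c |: S.
Proof. by move=> fl nSc; apply/setP=> c'; rewrite fl -flip_at_setU1. Qed.

Lemma partner_agree S S' c (k : 'I_4) : (c \in S') = (c \in S) ->
  partner S' (crossing_dart c k) = partner S (crossing_dart c k).
Proof. by rewrite /= => ->. Qed.

Lemma partner_crossing S c (k : 'I_4) :
  exists m : 'I_4, partner S (crossing_dart c k) = crossing_dart c m.
Proof. by rewrite /=; eexists; reflexivity. Qed.

Lemma crossing_circles S c (k : 'I_4) :
  circle D S (crossing_dart c k) = circle D S (crossing_dart c 0)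
  \/ circle D S (crossing_dart c k) = circle D S (crossing_dart c 2%:R).
Proof.
have := circle_opp_partner D S c 0; rewrite !add0r.
by elim/ord4P: k => -[] [E0 E2]; auto.
Qed.

Lemma circle_unaffected S S' c x : flip_at c S S' ->
  (forall k, crossing_dart c k \notin circle D S x) -> circle D S' x = circle D S x.
Proof.
move=> fl no_c; have sub S1 S2 : flip_at c S1 S2 ->
    (forall k, crossing_dart c k \notin circle D S1 x) -> circle D S2 x \subset circle D S1 x.
  move=> fl12 no_c1; apply/subsetP=> y xy.
  apply: (circle_preserves (P := mem (circle D S1 x)) _ _ xy (circle_refl D S1 x)) => d /= xd.
    by rewrite -circle_eq circle_arc circle_eq.
  suff ->: partner S2 d = partner S1 d by rewrite -circle_eq circle_partner circle_eq.
  case: d xd => [[c' k]|b] // xd; apply: partner_agree.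
  rewrite fl12; case: eqVneq xd => [->|_] // xd; by case/negP: (no_c1 k).
have sS : circle D S' x \subset circle D S x by apply: sub.
apply/eqP; rewrite eqEsubset sS sub //; first exact: flip_at_sym.
by move=> k; apply: contra (no_c k); apply: (subsetP sS).
Qed.

Lemma circle_flip S S' c : flip_at c S S' ->
  (#|circles D S'| + (separates D S c).*2 = #|circles D S| + 1)%N
  /\ separates D S' c = ~~ separates D S c.
Proof.
move=> fl; have [Sc|nSc] := boolP (c \in S); last first.
  rewrite (flip_at_setU1E fl nSc); split; first exact: card_circles_setU1.
  exact: separates_setU1.
have nSc : c \notin S' by rewrite fl eqxx Sc.
rewrite (flip_at_setU1E (flip_at_sym fl) nSc).
have := card_circles_setU1 D nSc; have := separates_setU1 D nSc; lia.
Qed.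

(** Circles that avoid [c] belong to both states. Those through [c] are [p] and [q] before the
    change and, as [separates] has been negated, a single circle after it. *)
Lemma circles_merge S S' c (p := circle D S (crossing_dart c 0))
    (q := circle D S (crossing_dart c 2%:R)) : flip_at c S S' -> separates D S c ->
  circles D S :\: circles D S' = [set p; q]
  /\ circles D S' :\: circles D S = [set p :|: q].
Proof.
move=> fl sepc; have [_ nsep] := circle_flip fl.
have p'q : p != q by [].
have pqk k : circle D S (crossing_dart c k) = p \/ circle D S (crossing_dart c k) = q.
  exact: crossing_circles.
pose r := circle D S' (crossing_dart c 0).
have rk k : circle D S' (crossing_dart c k) = r.
  have E02 : circle D S' (crossing_dart c 2%:R) = r.
    by apply/eqP; rewrite eq_sym -[_ == _]negbK -/(separates D S' c) nsep sepc.
  by case: (crossing_circles S' c k) => ->.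
have p0 : crossing_dart c 0 \in p by apply: circle_refl.
have q2 : crossing_dart c 2%:R \in q by apply: circle_refl.
have old_c C : C \in circles D S -> C \notin circles D S' -> C = p \/ C = q.
  move=> /circlesP[x ->] nC; have [k Ck|no_c] := pickP (fun k => crossing_dart c k \in circle D S x).
    by move: Ck => /circle_eqP ->; exact: pqk.
  case/negP: nC; rewrite -(circle_unaffected fl) ?circle_in // => k; exact/negbT.
have new_c C : C \in circles D S' -> C \notin circles D S -> C = r.
  move=> /circlesP[x ->] nC; have [k Ck|no_c] := pickP (fun k => crossing_dart c k \in circle D S' x).
    by move: Ck => /circle_eqP ->; exact: rk.
  case/negP: nC; rewrite -(circle_unaffected (flip_at_sym fl)) ?circle_in // => k; exact/negbT.
have p_sub k0 x : x \in circle D S (crossing_dart c k0) -> x \in r.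
  move=> xk; have [k Ck|no_c] := pickP (fun k => crossing_dart c k \in circle D S' x).
    by move: Ck; rewrite circle_sym rk.
  have: crossing_dart c k0 \in circle D S' x.
    rewrite -(circle_unaffected (flip_at_sym fl)); first by rewrite circle_sym.
    by move=> k; apply/negbT.
  by rewrite no_c.
have Dr : p :|: q = r.
  apply/eqP; rewrite eqEsubset; apply/andP; split; apply/subsetP=> x.
    by rewrite inE => /orP[]; apply: p_sub.
  (* The union is closed under the partner map of [S']: away from [c] this map is that of [S], and
     at [c] all four darts lie on [p] or [q]. *)
  move=> rx; have pqP d : d \in p :|: q -> circle D S d = p \/ circle D S d = q.
    by rewrite inE => /orP[] /circle_eqP <-; auto.
  have pqI d : circle D S d = p \/ circle D S d = q -> d \in p :|: q.
    by rewrite inE; case=> <-; rewrite circle_refl ?orbT.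
  apply: (circle_preserves (P := mem (p :|: q)) _ _ rx) => [d /pqP dpq|d /pqP dpq|] /=.
  - by apply: pqI; rewrite circle_arc.
  - apply: pqI; case: d dpq => [[c' k]|b] dpq; last first.
      by rewrite -(circle_partner D S) in dpq.
    have [->|c'c] := eqVneq c' c; first by case: (partner_crossing S' c k) => m /= ->; apply: pqk.
    rewrite (_ : partner S' _ = partner S (inl (c', k))) ?circle_partner //.
    by apply: partner_agree; rewrite fl (negPf c'c).
  by rewrite inE p0.
have pS : p \in circles D S by apply: circle_in.
have qS : q \in circles D S by apply: circle_in.
have rS : r \in circles D S' by apply: circle_in.
have r0 : crossing_dart c 0 \in r by apply: circle_refl.
have r2 : crossing_dart c 2%:R \in r by rewrite -Dr inE q2 orbT.
have npS : p \notin circles D S'.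
  apply/negP=> pS'; have Dp := circle_of pS' p0; case/eqP: p'q.
  by rewrite [q](_ : _ = p) //; symmetry; apply: (circle_of pS); rewrite Dp.
have nqS : q \notin circles D S'.
  apply/negP=> qS'; have Dq := circle_of qS' q2; case/eqP: p'q.
  by symmetry; apply: (circle_of qS); rewrite Dq rk.
have nrS : r \notin circles D S.
  apply/negP=> rS1; case/eqP: p'q; rewrite -[LHS](circle_of rS1 r0).
  exact: (circle_of rS1 r2).
split; apply/setP=> C.
  rewrite in_setD in_set2; apply/andP/orP => [[C1 C2]|].
    by case: (old_c C C2 C1) => ->; rewrite eqxx; auto.
  by case=> /eqP->.
rewrite in_setD in_set1 Dr; apply/andP/eqP => [[C1 C2]|->] //.
exact: new_c.
Qed.

Definition circle_end0 S c := circle D S (crossing_dart c 0).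
Definition circle_end2 S c := circle D S (crossing_dart c 2%:R).

(** The graph with the circles of [S] as vertices and the crossings as edges; for the oriented state
    it is the Seifert graph. *)
Definition circle_joins S c (u v : {set dart n}) : bool :=
  (u == circle_end0 S c) && (v == circle_end2 S c)
  || (u == circle_end2 S c) && (v == circle_end0 S c).

Lemma circle_joinsE S c u v : circle_joins S c u v =
  (u == circle_end0 S c) && (v == circle_end2 S c)
  || (u == circle_end2 S c) && (v == circle_end0 S c).
Proof. by []. Qed.

Lemma linked_crossing S (L : {set 'I_n}) c (k m : 'I_4) : c \in L ->
  linked (circle_joins S) L (circle D S (crossing_dart c k)) (circle D S (crossing_dart c m)).
Proof.
move=> Lc; have L02 := linked_ends (circle_joinsE S) Lc.
have L20 := L02; rewrite (linked_sym (circle_joinsE S)) in L20.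
by case: (crossing_circles S c k) => ->; case: (crossing_circles S c m) => ->;
  rewrite ?linked_refl ?L02 ?L20.
Qed.

(** Along a circle of [S'], one passes from one circle of [S] to another only at a crossing where
    the two states differ, and these crossings lie in [L]. *)
Lemma linked_circles S S' (L : {set 'I_n}) x y :
  (forall c, c \notin L -> (c \in S') = (c \in S)) -> y \in circle D S' x ->
  linked (circle_joins S) L (circle D S x) (circle D S y).
Proof.
move=> agree xy; pose P d := linked (circle_joins S) L (circle D S x) (circle D S d).
apply: (circle_preserves (P := P) _ _ xy) => [d|d|]; rewrite /P ?circle_arc ?linked_refl // => Pd.
case: d Pd => [[c k]|b] Pd; last by rewrite -(circle_partner D S (inr b)) in Pd.
have [Lc|nLc] := boolP (c \in L); last first.
  by rewrite (partner_agree (S := S)) ?circle_partner // agree.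
by case: (partner_crossing S' c k) => m ->; apply: linked_trans Pd (linked_crossing _ _ _ Lc).
Qed.

End Flip.

(** * Planarity of the Tait graph *)

Section Tait.
Variables (n : nat) (D : diagram n).
Implicit Types (S H K : {set 'I_n}) (c : 'I_n) (d x y : dart n).
Local Notation tait := (tait_joins D).

Lemma face_step_inj : injective (face_step (arc D)).
Proof. exact: inj_comp (can_inj (@cwK n)) (inv_inj (@arcK _ D)). Qed.

Lemma region_eq x y : (region D x == region D y) = fconnect (face_step (arc D)) x y.
Proof.
apply/eqP/idP => [/setP/(_ y)|xy]; first by rewrite !inE connect0.
by apply/setP=> w; rewrite !inE (same_connect (fconnect_sym face_step_inj) xy).
Qed.

Lemma region_face_step x : region D (face_step (arc D) x) = region D x.
Proof. by apply/esym/eqP; rewrite region_eq fconnect1. Qed.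

(** The black region beside the arc of [d]; it lies to the left of exactly one of the two darts of
    this arc. *)
Definition black_region_of d := region D (if black D d then d else arc D d).

Lemma black_region_of_arc d : black_region_of (arc D d) = black_region_of d.
Proof. by rewrite /black_region_of black_arc arcK; case: (black D d). Qed.

Lemma black_region_of_ccw d : black D d -> black_region_of (ccw d) = black_region_of d.
Proof.
move=> bd; rewrite /black_region_of black_ccw bd /= -[LHS]region_face_step.
by rewrite /face_step arcK ccwK.
Qed.

Lemma black_region_of_in d : black_region_of d \in tait_vertices D.
Proof.
by apply/imset_f; case: ifP => bd; rewrite -[_ \in _]/(black D _) ?black_arc bd.
Qed.

Lemma tait_verticesP v : reflect (exists2 d, black D d & v = black_region_of d) (v \in tait_vertices D).
Proof.
apply: (iffP imsetP) => [[d bd ->]|[d bd ->]]; exists d => //.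
  by rewrite /black_region_of (bd : black D d).
by rewrite /black_region_of bd.
Qed.

Definition black_corner c : 'I_4 := if black D (crossing_dart c 0) then 0 else 1.

Lemma black_cornerP c : black D (crossing_dart c (black_corner c)).
Proof.
rewrite /black_corner; case: ifP => // w0.
have ->: crossing_dart c 1 = ccw (crossing_dart c 0) by rewrite /= add0r.
by rewrite black_ccw w0.
Qed.

Definition tait_end0 c := black_region_of (crossing_dart c (black_corner c)).
Definition tait_end2 c := black_region_of (crossing_dart c (black_corner c + 2%:R)).

Lemma black_opp_corner c : black D (crossing_dart c (black_corner c + 2%:R)).
Proof. by rewrite black_opp black_cornerP. Qed.

Lemma black_cornerE c k :
  black D (crossing_dart c k) -> k = black_corner c \/ k = black_corner c + 2%:R.
Proof.
move=> bk; have [j Dk] : exists j, k = black_corner c + j by exists (k - black_corner c); rewrite addrC subrK.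
subst k; elim/ord4P: j bk; rewrite ?addr0; auto.
  by rewrite black_succ black_cornerP.
by rewrite (natrD _ 2 1) addrA black_succ black_opp black_cornerP.
Qed.

Lemma tait_joinsE c u v : tait c u v =
  (u == tait_end0 c) && (v == tait_end2 c) || (u == tait_end2 c) && (v == tait_end0 c).
Proof.
have brE k : black D (crossing_dart c k) ->
  region D (crossing_dart c k) = black_region_of (crossing_dart c k).
  by rewrite /black_region_of => ->.
apply/existsP/orP => [[k /and3P[bk]]|].
  rewrite !brE ?black_opp // => /eqP-> /eqP->.
  by case: (black_cornerE bk) => ->; rewrite ?ord4_add22 ?eqxx /tait_end0 /tait_end2 ?eqxx; auto.
case=> /andP[/eqP-> /eqP->]; [exists (black_corner c) | exists (black_corner c + 2%:R)];
  by rewrite ?ord4_add22 !brE ?black_opp_corner ?black_cornerP ?eqxx.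
Qed.

Lemma mem_state_of H c :
  (c \in state_of D H) = (black D (crossing_dart c 1) (+) (c \in H)).
Proof.
by rewrite !inE /joins_black; case: (black D _); case: (c \in H).
Qed.

(** The corner between a black dart and its [ccw] is black. Outside [H] the circle cuts this corner
    off; at an edge of [H] it rounds the neighbouring white corner, which leaves the black corners
    joined. *)
Lemma partner_state_of H c k : black D (crossing_dart c k) ->
  partner (state_of D H) (crossing_dart c k)
  = if c \in H then cw (crossing_dart c k) else ccw (crossing_dart c k).
Proof.
move=> bk; rewrite [partner _ _]/= mem_state_of addbA.
suff ->: odd k = black D (crossing_dart c 1) by rewrite addbb; case: (c \in H).
have [[[E1 E2] E3] _] := ord4_succ; elim/ord4P: k bk.
- by rewrite -E1 black_succ => ->.
- by [].
- by rewrite -E2 black_succ /= => /negPf->.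
by rewrite -E3 black_succ -E2 black_succ negbK.
Qed.

Lemma flip_state_of c H H' : flip_at c H H' -> flip_at c (state_of D H) (state_of D H').
Proof. by move=> fl c'; rewrite !mem_state_of fl addbCA. Qed.

Lemma tait_partner_linked H d :
  linked tait H (black_region_of d) (black_region_of (partner (state_of D H) d)).
Proof.
wlog bd : d / black D d.
  move=> IH; have [bd|wd] := boolP (black D d); first exact: IH.
  rewrite (linked_sym tait_joinsE) -{2}(partnerK (state_of D H) d); apply: IH.
  by rewrite black_partner.
case: d bd => [[c k]|b] bd; last by rewrite (black_region_of_ccw bd) linked_refl.
rewrite partner_state_of //; case: ifP => Hc; last by rewrite (black_region_of_ccw bd) linked_refl.
have bcc : black D (cw (cw (inl (c, k)))) by rewrite !black_cw negbK.
have := black_region_of_ccw bcc; rewrite cwK => ->.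
have L02 := linked_ends tait_joinsE Hc; have L20 := L02; rewrite (linked_sym tait_joinsE) in L20.
have -> : cw (cw (inl (c, k))) = crossing_dart c (k + 2%:R).
  by rewrite /=; congr (inl (c, _)); elim/ord4P: (k); apply: val_inj.
by case: (black_cornerE bd) => -> //; rewrite ord4_add22.
Qed.

Lemma tait_circle_linked H x y : y \in circle D (state_of D H) x ->
  linked tait H (black_region_of x) (black_region_of y).
Proof.
move=> xy; pose P d := linked tait H (black_region_of x) (black_region_of d).
apply: (circle_preserves (P := P) _ _ xy) => [d|d|]; rewrite /P ?linked_refl //.
  by rewrite black_region_of_arc.
by move=> Pd; apply: linked_trans Pd (tait_partner_linked _ _).
Qed.

Lemma tait_connected x y : linked tait setT (black_region_of x) (black_region_of y).
Proof.
pose P d := linked tait setT (black_region_of x) (black_region_of d).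
apply: (connect_preserves (P := P) _ (diagram_connected D x y)); last exact: linked_refl.
move=> {}y z Py /orP[] /eqP->; first by rewrite /P black_region_of_arc.
apply: linked_trans Py _; have [by_|wy] := boolP (black D y).
  by rewrite black_region_of_ccw // linked_refl.
have bc : black D (ccw y) by rewrite black_ccw.
have := tait_partner_linked setT (ccw y).
have ->: partner (state_of D setT) (ccw y) = y.
  case: y bc {wy} => [[c k]|b] bc; last by rewrite /= negbK.
  by rewrite [ccw _]/= partner_state_of // inE (ccwK (inl (c, k))).
by rewrite (linked_sym tait_joinsE).
Qed.

Lemma tait_spanning_connected H :
  (forall u v, linked tait setT u v -> linked tait H u v) ->
  spanning_connected (tait_vertices D) tait H.
Proof.
move=> TH; apply/forallP=> u; apply/implyP=> /tait_verticesP[x _ ->].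
apply/forallP=> v; apply/implyP=> /tait_verticesP[y _ ->]; exact/TH/tait_connected.
Qed.

Lemma separates_tait H c : separates D (state_of D H) c =
  (circle D (state_of D H) (crossing_dart c (black_corner c))
   != circle D (state_of D H) (crossing_dart c (black_corner c + 2%:R))).
Proof. exact: separatesE. Qed.

(** One direction of [separates_notin]: a circle runs along a single component of [H]. *)
Lemma unlinked_separates H c : ~~ linked tait H (tait_end0 c) (tait_end2 c) ->
  separates D (state_of D H) c.
Proof.
by rewrite separates_tait; apply: contra; rewrite circle_eq => /tait_circle_linked.
Qed.

(** When every corner of one colour is cut off, the circles run around the regions of that
    colour. *)
Lemma card_circles_color S (col : bool) :
  (forall d, black D d = col -> partner S d = ccw d) ->
  #|circles D S| = #|region D @: [set d | black D d == col]|.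
Proof.
move=> pS; rewrite /circles (imset_black_all col (circle_arc D S)).
apply: card_imset_kernel => x y; rewrite !inE => /eqP bx /eqP by_; split=> [/eqP|/eqP].
  rewrite circle_eq => xy; pose h d := region D (if black D d == col then d else arc D d).
  have harc d : h (arc D d) = h d.
    by rewrite /h black_arc arcK; case: (black D d); case: (col).
  have hcol d : black D d = col -> h (partner S d) = h d.
    move=> bd; rewrite pS // /h black_ccw bd eqxx eqb_negLR -[LHS]region_face_step.
    by case: (col); rewrite /= /face_step arcK ccwK.
  have hpartner d : h (partner S d) = h d.
    have [/hcol//|d'] := eqVneq (black D d) col.
    have bp : black D (partner S d) = col.
      by rewrite black_partner; case: (black D d) d'; case: (col).
    by rewrite -[LHS](hcol _ bp) partnerK.
  by have := circle_const harc hpartner xy; rewrite /h bx by_ eqxx.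
rewrite region_eq => xy; apply/eqP; rewrite circle_eq.
pose P d := (black D d == col) && (d \in circle D S x).
suff: P y by case/andP.
apply: (connect_preserves (P := P) _ xy); last by rewrite /P bx eqxx circle_refl.
move=> u v /andP[/eqP bu xu] /eqP <-; rewrite /P black_region bu eqxx /=.
have bfu : black D (face_step (arc D) u) = col by rewrite black_region.
rewrite -circle_eq -(circle_partner D S (face_step _ u)) (pS _ bfu).
by rewrite /face_step cwK circle_arc circle_eq.
Qed.

Lemma card_circles_empty : #|circles D (state_of D set0)| = #|tait_vertices D|.
Proof.
rewrite (card_circles_color (col := true)).
  by congr #|pred_of_set _|; apply/setP=> v; apply/imsetP/imsetP => -[d bd ->];
    exists d; rewrite // inE eqb_id in bd *.
case=> [[c k]|b] // bd; by rewrite partner_state_of // inE.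
Qed.

Lemma card_circles_full : #|circles D (state_of D setT)| = #|region D @: [set d | black D d == false]|.
Proof.
apply: card_circles_color => d wd; have bc : black D (ccw d) by rewrite black_ccw wd.
apply: (inv_inj (@partnerK _ (state_of D setT))); rewrite partnerK.
case: d bc {wd} => [[c k]|b] bc; last by rewrite /= negbK.
by rewrite [ccw _]/= partner_state_of // inE (ccwK (inl (c, k))).
Qed.

Lemma card_froots_le_image (U T : finType) (f : T -> T) (h : T -> U) :
  (forall u v, h u = h v -> fconnect f u v) -> injective f -> (fcard f T <= #|h @: T|)%N.
Proof.
move=> hP f_inj; rewrite (@leq_trans #|h @: [set x | froots f x]|) //; last first.
  exact/subset_leq_card/imsetS/subsetP.
rewrite card_in_imset; last first.
  move=> x y; rewrite !inE => /eqP rx /eqP ry /hP.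
  by rewrite -(root_connect (fconnect_sym f_inj)) rx ry => /eqP.
by apply/subset_leq_card/subsetP=> x; rewrite !inE andbT.
Qed.

Lemma card_dart : #|{: dart n}| = (4 * n + 2)%N.
Proof. by rewrite card_sum card_prod !card_ord card_bool mulnC. Qed.

Lemma fcard_arc : (fcard (arc D) (dart n) = 2 * n + 1)%N.
Proof.
have := @fcard_order_set _ (arc D) (inv_inj (@arcK _ D)) 2 (dart n).
rewrite card_dart => E; suff: (fcard (arc D) (dart n) * 2 = 4 * n + 2)%N by lia.
apply: E => //; apply/subsetP=> d _; rewrite inE; apply/eqP.
apply: (@order_cycle _ _ [:: d; arc D d]); rewrite ?mem_head //=.
  by rewrite arcK !eqxx.
by rewrite inE eq_sym arc_neq.
Qed.

Lemma fcard_ccw : (fcard (@ccw n) (dart n) <= n + 1)%N.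
Proof.
(* The orbits of [ccw] are the vertices; [None] stands for the dot. *)
pose h (d : dart n) : option 'I_n := if d is inl (c, _) then Some c else None.
apply: (@leq_trans #|h @: dart n|); last first.
  by apply: leq_trans (max_card _) _; rewrite card_option card_ord addn1.
apply: card_froots_le_image; last exact: can_inj (@ccwK n).
case=> [[c k]|b] [[c' k']|b'] //= => [[<-]|_].
  have step m : fconnect (@ccw n) (inl (c, k)) (iter m (@ccw n) (inl (c, k))) by apply: fconnect_iter.
  have [m ->]: exists m : nat, k' = k + m%:R :> 'I_4.
    exists (k' - k : 'I_4); rewrite natr_Zp; by rewrite addrC subrK.
  suff <-: iter m (@ccw n) (inl (c, k)) = inl (c, k + m%:R) by [].
  by elim: m => [|m IHm]; rewrite ?addr0 //= IHm /= -addrA natr1.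
have [<-|b'b] := eqVneq b b'; first exact: connect0.
apply: connect1; apply/eqP; congr inr; by case: b b' b'b => -[].
Qed.

(** With at most [n + 1] vertices and exactly [2 * n + 1] arcs, Euler's formula forces at least
    [n + 2] regions. The circles of the empty subgraph go around the black ones, those of the full
    subgraph around the white ones. The opposite inequality follows from [planarity_mono]. *)
Lemma euler_circles :
  (n + 2 <= #|circles D (state_of D set0)| + #|circles D (state_of D setT)|)%N.
Proof.
rewrite card_circles_empty card_circles_full.
have := diagram_planar D; rewrite fcard_arc.
have := fcard_ccw.
have : (fcard (face_step (arc D)) (dart n) <= #|region D @: dart n|)%N.
  apply: card_froots_le_image face_step_inj => x y /eqP; by rewrite region_eq.
suff : (#|region D @: dart n| <= #|tait_vertices D| + #|region D @: [set d | black D d == false]|)%N by lia.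
apply: leq_trans (leq_card_setU _ _); apply/subset_leq_card/subsetP=> _ /imsetP[d _ ->].
rewrite inE; have [bd|wd] := boolP (black D d); first by rewrite imset_f.
by rewrite [X in _ || X]imset_f ?orbT // inE (negPf wd).
Qed.

Let nc H := #|circles D (state_of D H)|.
Let comp H := num_components tait (tait_vertices D) H.

(** The summand with the conjunction is the defect: 2 is lost when [c] closes a cycle of [H] and yet
    merges two circles, which is what has to be excluded on the sphere. *)
Lemma planarity_step H c : c \notin H ->
  (nc (c |: H) + 2 * comp H + 2 * (linked tait H (tait_end0 c) (tait_end2 c)
      && separates D (state_of D H) c) <= nc H + 1 + 2 * comp (c |: H))%N.
Proof.
move=> nHc; have := (circle_flip D (flip_state_of (flip_at_setU1 nHc))).1.
rewrite -/(nc _) -/(nc _); have [Lc|nLc] := boolP (linked tait H _ _).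
  have := num_components_setU1_linked tait_joinsE (tait_vertices D) Lc; rewrite -/(comp _) -/(comp _).
  lia.
have := num_components_setU1 tait_joinsE (tait_vertices D) H c; rewrite -/(comp _) -/(comp _).
rewrite unlinked_separates //; lia.
Qed.

Lemma planarity_mono H K : H \subset K ->
  (nc K + 2 * comp H + #|H| <= nc H + 2 * comp K + #|K|)%N.
Proof.
have [m] := ubnP #|K :\: H|; elim: m H => // m IHm H; rewrite ltnS => leKHm sHK.
have [DK|[c /setDP[Kc nHc]]] := set_0Vmem (K :\: H).
  suff ->: H = K by [].
  by apply/eqP; rewrite eqEsubset sHK -setD_eq0 DK eqxx.
have := planarity_step nHc; have := IHm (c |: H); rewrite cardsU1 nHc subUset sub1set Kc sHK.
have: (#|K :\: (c |: H)| < m)%N.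
  apply: leq_trans leKHm; rewrite (cardsD1 c (K :\: H)) inE Kc nHc add1n ltnS.
  by apply/subset_leq_card/subsetP=> e; rewrite !inE negb_or => /andP[/andP[-> ->] ->].
move=> -> /(_ isT isT); rewrite add1n.
move: (nc K) (nc H) (nc (c |: H)) (comp H) (comp K) (comp (c |: H)); lia.
Qed.

(* The quantity [nc H - 2 * comp H - #|H|] does not increase when edges are
   added; by Euler's formula it takes the same value on [set0] and [setT], so it
   is constant. *)
Lemma separates_notin H c : c \notin H ->
  separates D (state_of D H) c = ~~ linked tait H (tait_end0 c) (tait_end2 c).
Proof.
move=> nHc; have := planarity_step nHc; have := unlinked_separates (H := H) (c := c).
have := planarity_mono (sub0set H); have := planarity_mono (subsetT (c |: H)).
have comp0 : comp set0 = nc set0 by rewrite /comp (num_components0 tait_joinsE) /nc card_circles_empty.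
have compT : (comp setT <= 1)%N.
  by apply: (num_components_connected tait_joinsE); apply: tait_spanning_connected.
have := euler_circles; rewrite -/(nc _) -/(nc _) cardsU1 nHc cards0 comp0 cardsT card_ord.
case: (separates _ _ _) => //=; case: (linked _ _ _ _) => //=; last by move=> _ _ _ /(_ isT).
rewrite add1n; move: (nc set0) (nc setT) (nc H) (nc (c |: H)) (comp H) (comp (c |: H)) (comp setT) compT.
move=> a0 aT aH aH1 cH cH1 cT; lia.
Qed.

(** Deleting [c] negates [separates], which reduces the claim to [separates_notin]. *)
Lemma separates_in H c : c \in H ->
  separates D (state_of D H) c = ~~ bridge tait tait_end0 tait_end2 H c.
Proof.
move=> Hc; have nHc : c \notin H :\ c by rewrite !inE eqxx.
have := (circle_flip D (flip_state_of (flip_at_setU1 nHc))).2.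
by rewrite setD1K // (separates_notin nHc) => ->.
Qed.

End Tait.

(** * The oriented state and the orientation preserving tree *)

Section Seifert.
Variables (n : nat) (D : diagram n).
Implicit Types (S H K : {set 'I_n}) (c e f : 'I_n) (d x y : dart n).
Local Notation tait := (tait_joins D).

(** The oriented state: the oriented resolution is the B-smoothing exactly at the negative
    crossings. *)
Definition seifert : {set 'I_n} := [set c | ~~ positive_crossing D c].

Lemma mem_seifert c : (c \in seifert) = ~~ positive_crossing D c.
Proof. exact: in_set. Qed.

(** The colour sigma: false when black lies to the left of the oriented arc. From one dart of a
    Seifert circle to the next, direction and colour change together. *)
Definition seifert_color (d : dart n) : bool := outgoing D d (+) black D d.

Lemma mem_red c : (c \in red_edges D)
  = black D (crossing_dart c (if positive_crossing D c then 1 else 0)).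
Proof. by rewrite inE /joins_black /oriented_smoothing; case: ifP. Qed.

Lemma black1 c : black D (crossing_dart c 1) = ~~ black D (crossing_dart c 0).
Proof. by rewrite -black_ccw /= add0r. Qed.

Lemma red_positive_edge c : positive_crossing D c ->
  (c \in red_edges D) = (c \in positive_edges D).
Proof. by rewrite mem_red inE => ->. Qed.

Lemma red_negative_edge c : ~~ positive_crossing D c ->
  (c \in red_edges D) = (c \notin positive_edges D).
Proof. by move=> nc; rewrite mem_red inE /joins_black (negPf nc) black1 negbK. Qed.

Lemma state_of_red : state_of D (red_edges D) = seifert.
Proof.
apply/setP=> c; rewrite mem_state_of mem_red inE.
by case: ifP; rewrite black1; case: (black D _).
Qed.

Lemma outgoing_opp c k :
  outgoing D (crossing_dart c (k + 2%:R)) = ~~ outgoing D (crossing_dart c k).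
Proof. by rewrite -outgoing_across /across /= -addrA. Qed.

Lemma seifert_color_arc d : seifert_color (arc D d) = seifert_color d.
Proof. by rewrite /seifert_color outgoing_arc black_arc addbN addNb negbK. Qed.

Lemma seifert_color_partner d : seifert_color (partner seifert d) = seifert_color d.
Proof.
suff Dout: outgoing D (partner seifert d) = ~~ outgoing D d.
  by rewrite /seifert_color Dout black_partner addbN addNb negbK.
case: d => [[c k]|b]; last exact: (outgoing_across D (dot_dart n b)).
rewrite /= inE /positive_crossing.
have E2 := outgoing_opp c 0; have E3 := outgoing_opp c 1; rewrite !ord4_add2 in E2 E3.
have E m : outgoing D (inl (c, m)) = outgoing D (crossing_dart c m) by [].
elim/ord4P: k; rewrite /= ?(ord4_succ, ord4_pred) !E E2 ?E3.
all: case o0: (outgoing D (crossing_dart c 0)); case o1: (outgoing D (crossing_dart c 1)).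
all: by rewrite /= ?E2 ?E3 ?o0 ?o1.
Qed.

Lemma seifert_color_opp c k :
  seifert_color (crossing_dart c (k + 2%:R)) = ~~ seifert_color (crossing_dart c k).
Proof. by rewrite /seifert_color outgoing_opp black_opp addNb. Qed.

Lemma separates_seifert c : separates D seifert c.
Proof.
rewrite /separates circle_eq; apply/negP=> /(circle_const seifert_color_arc seifert_color_partner).
by have := seifert_color_opp c 0; rewrite add0r => -> /esym/eqP; case: (seifert_color _).
Qed.

(** Here planarity meets the orientation. The Seifert circles at a crossing are distinct, so every
    red edge lies on a cycle of red edges and, by the next lemma, every black edge joins two
    components of the red subgraph. *)
Lemma red_bridgeless c : c \in red_edges D ->
  ~~ bridge tait (tait_end0 D) (tait_end2 D) (red_edges D) c.
Proof. by move=> /separates_in <-; rewrite state_of_red separates_seifert. Qed.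

Lemma black_joins_components c : c \notin red_edges D ->
  ~~ linked tait (red_edges D) (tait_end0 D c) (tait_end2 D c).
Proof. by move=> /separates_notin <-; rewrite state_of_red separates_seifert. Qed.

Section Tree.
Variable T : {set 'I_n}.
Hypothesis T_pres : orientation_preserving_tree D T.
Local Notation red := (red_edges D).
Local Notation end0 := (tait_end0 D).
Local Notation end2 := (tait_end2 D).
Local Notation tbridge := (bridge tait end0 end2).
Let joinsE := tait_joinsE D.

Lemma tree_structure : exists H1 H2 H3 : {set 'I_n},
  [/\ [/\ H1 \subset red, {subset red :\: H1 <= positive_edges D}
        & forall e, e \in H1 -> e \in positive_edges D -> tbridge H1 e],
      [/\ H2 \subset H1, forall e, e \in H2 -> e \notin positive_edges D -> tbridge H2 e
        & forall u v, linked tait red u v -> linked tait H2 u v],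
      [/\ T \subset H3, H3 \subset H2 :|: ~: red,
          {subset ~: red :\: H3 <= positive_edges D}
        & forall e, e \in H3 -> e \notin red -> e \in positive_edges D -> tbridge H3 e],
      [/\ H2 \subset T & forall e, e \in T -> e \notin red -> e \notin positive_edges D -> tbridge T e]
    & forall u v, linked tait setT u v -> linked tait T u v].
Proof.
case: T_pres => H1 [H2 [H3 [/(prunedP joinsE)[s1 r1 l1 b1] /(prunedP joinsE)[s2 r2 l2 b2]]]].
move=> /(prunedP joinsE)[s3 r3 l3 b3] /(prunedP joinsE)[s4 r4 l4 b4].
have L2 u v : linked tait red u v -> linked tait H2 u v by rewrite l2 l1.
have sH2 : H2 \subset red := subset_trans s2 s1.
(* The last two prunings remove black edges only, so the red subgraph [H2] survives in [H3] and in
   [T]. *)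
have sH23 : H2 \subset H3.
  apply/subsetP=> e H2e; apply: contraT => nH3e.
  have := subsetP r3 e; rewrite !inE H2e nH3e /= => /(_ isT)/andP[_].
  by have := subsetP sH2 e H2e; rewrite inE => ->.
have sH2T : H2 \subset T.
  apply/subsetP=> e H2e; apply: contraT => nTe.
  have := subsetP r4 e; rewrite !inE (subsetP sH23) // nTe /= => /(_ isT)/andP[_].
  by have := subsetP sH2 e H2e; rewrite inE => ->.
exists H1, H2, H3; split; [split=> // | split=> // | split=> // | split=> // | ].
- exact/subsetP.
- by move=> e H2e npos; apply: b2; rewrite // in_setC.
- move=> e; rewrite in_setD in_setC => /andP[nH3 nred].
  have := subsetP r3 e; rewrite in_setD nH3 inE [e \in black_edges D]in_setC nred orbT.
  by move=> /(_ isT) /setIP[].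
- by move=> e H3e nred pos; apply: b3; rewrite // inE pos in_setC.
- by move=> e Te nred npos; apply: b4; rewrite // inE !in_setC npos.
move=> u v; rewrite l4 l3; apply: (linked_sub_rel joinsE) => e _.
have [rede|nrede] := boolP (e \in red); last first.
  by apply: (linked_ends joinsE); rewrite inE [e \in black_edges D]in_setC nrede orbT.
apply: (linkedS joinsE (subsetUl _ _)); exact/L2/(linked_ends joinsE).
Qed.

Lemma tree_spanning u v : linked tait setT u v -> linked tait T u v.
Proof. by case: tree_structure => H1 [H2 [H3 [_ _ _ _]]]; apply. Qed.

Lemma tree_red_linked c : c \in red -> linked tait (T :&: red) (end0 c) (end2 c).
Proof.
case: tree_structure => H1 [H2 [H3 [[s1 _ _] [s2 _ L2] _ [sT _] _]]] redc.
apply: (linkedS joinsE) (L2 _ _ (linked_ends joinsE redc)).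
by rewrite subsetI sT (subset_trans s2).
Qed.

(** The last two prunings make every black edge of [T] a bridge. A cycle of [T] through a red edge
    would avoid these bridges and lie in [H2], all of whose edges are bridges by the first two
    prunings. *)
Lemma tree_bridge e : e \in T -> tbridge T e.
Proof.
case: tree_structure => H1 [H2 [H3 [[s1 r1 b1] [s2 b2 L2] [sT3 s3 r3 b3] [sH2T bT] _]]].
have black_bridge f : f \in T -> f \notin red -> tbridge T f.
  move=> Tf nred; have [pos|npos] := boolP (f \in positive_edges D); last exact: bT.
  by apply: (bridgeS joinsE sT3); apply: b3; rewrite // (subsetP sT3).
move=> Te; have [rede|nrede] := boolP (e \in red); last exact: black_bridge.
have TH2 f : f \in T -> f \in red -> f \in H2.
  by move=> Tf redf; have := subsetP s3 f (subsetP sT3 f Tf); rewrite in_setU in_setC redf orbF.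
have H2e := TH2 e Te rede.
apply/negP=> Tab; have bH2 : tbridge H2 e.
  have [pos|npos] := boolP (e \in positive_edges D); last exact: b2.
  by apply: (bridgeS joinsE s2); apply: b1; rewrite // (subsetP s2).
case/negP: bH2; have /(_ (T :\: red)) := linked_avoid_bridges joinsE _ Te _ Tab.
move=> IH; apply: linkedS (IH _ _) => //.
- apply/subsetP=> f; rewrite !in_setD !in_set1 => /andP[nTr /andP[-> Tf]] /=.
  by apply: TH2 => //; apply: contraR nTr => ->.
- by move=> f /setDP[Tf nred]; apply: black_bridge.
by rewrite inE rede.
Qed.

(** The symmetric difference of the red edges and the tree; [live_edgesE] identifies it with the set
    of live edges. *)
Definition tree_live : {set 'I_n} := (red :\: T) :|: (T :\: red).
Definition positive_live : {set 'I_n} := tree_live :\: seifert.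

Lemma not_tree_live c : c \notin tree_live -> (c \in red) = (c \in T).
Proof. by rewrite !in_setU !in_setD; case: (c \in T); case: (c \in red). Qed.

Lemma tree_live_agree c : c \notin tree_live ->
  (c \in state_of D T) = (c \in seifert).
Proof. by move/not_tree_live=> Dc; rewrite -state_of_red !mem_state_of Dc. Qed.

(** Here the order of pruning, positive edges before negative ones, is essential. If [c] is not
    itself live, it suffices to find a subgraph that agrees with the red one outside [positive_live]
    and in whose state the two circles at [c] coincide: [linked_circles] then links the Seifert
    circles at [c]. *)
Lemma positive_live_linked c : c \notin seifert ->
  linked (circle_joins D seifert) positive_live
    (circle_end0 D seifert c) (circle_end2 D seifert c).
Proof.
move=> pos; have [Lc|nLc] := boolP (c \in positive_live).
  exact: (linked_ends (circle_joinsE D seifert) Lc).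
have Dc : (c \in red) = (c \in T).
  by apply: not_tree_live; apply: contra nLc => Lc; rewrite in_setD pos.
have pc : positive_crossing D c by rewrite mem_seifert negbK in pos.
have same_linked H : ~~ separates D (state_of D H) c ->
   (forall c', c' \notin positive_live -> (c' \in H) = (c' \in red)) ->
   linked (circle_joins D seifert) positive_live
    (circle_end0 D seifert c) (circle_end2 D seifert c).
  rewrite negbK circle_eq => same agree; apply: (linked_circles _ same) => c' nL.
  by rewrite -state_of_red !mem_state_of agree.
have liveI c' : positive_crossing D c' -> (c' \in red) != (c' \in T) -> c' \in positive_live.
  move=> pc'; rewrite in_setD mem_seifert negbK pc' !in_setU !in_setD /=.
  by case: (c' \in red); case: (c' \in T).
have posE c' : (c' \in red) = (c' \in positive_edges D) -> positive_crossing D c'.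
  move=> E; apply: contraT => npc; have := red_negative_edge npc.
  by rewrite E; case: (c' \in _).
case: tree_structure => H1 [H2 [H3 [[s1 r1 b1] [s2 b2 L2] [sT3 s3 r3 b3] [sH2T bT] spT]]].
have TH2 f : f \in T -> f \in red -> f \in H2.
  by move=> Tf redf; have := subsetP s3 f (subsetP sT3 f Tf); rewrite in_setU in_setC redf orbF.
have [redc|nredc] := boolP (c \in red).
  (* A red edge at a positive crossing is positive, hence a bridge of [H1]. The edges that [H1]
     lacks are positive, red and outside [T], so they belong to [positive_live]. *)
  have H1c : c \in H1 by apply: (subsetP s2); apply: TH2; rewrite -?Dc.
  apply: (same_linked H1) => [|c' nL].
    by rewrite separates_in // negbK b1 // -red_positive_edge.
  apply/idP/idP => [|red_c']; first exact: (subsetP s1).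
  apply: contraR nL => nH1; have posc' := r1 c'; rewrite in_setD nH1 red_c' in posc'.
  apply: liveI; first by apply: posE; rewrite red_c' posc'.
  by rewrite red_c'; apply: contra nH1 => /eqP/esym Tc'; apply: (subsetP s2); apply: TH2.
have nTc : c \notin T by rewrite -Dc.
have nposc : c \notin positive_edges D by rewrite -red_positive_edge.
have H3c : c \in H3.
  by apply: contraR nposc => nH3; apply: r3; rewrite in_setD nH3 in_setC.
(* Now [c] is a negative black edge outside [T]. The edges of [F] are bridges of [H3], hence of
   [c |: T], so the path of [T] between the ends of [c] avoids them. The black edges of [T] not in
   [F] are negative, so they sit at positive crossings and are live. *)
pose F := (T :\: red) :&: positive_edges D.
have TFc : linked tait (T :\: F) (end0 c) (end2 c).
  have /(_ (c |: T) F c) := linked_avoid_bridges joinsE; rewrite setU1K // setU11 => IH.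
  apply: IH => //; last by apply/spT/(linked_ends joinsE); rewrite inE.
    move=> f /setIP[/setDP[Tf nred] posf].
    have sK : c |: T \subset H3 by rewrite subUset sub1set H3c.
    by apply: (bridgeS joinsE sK); apply: b3; rewrite // (subsetP sT3).
  by rewrite inE in_setD (negPf nTc) andbF.
apply: (same_linked (red :|: (T :\: F))) => [|c' nL].
  rewrite separates_notin; first by rewrite negbK (linkedS joinsE _ TFc) // subsetUr.
  by rewrite in_setU negb_or nredc in_setD (negPf nTc) andbF.
rewrite in_setU; have [//|nred_c'] := boolP (c' \in red); rewrite /=.
apply: contraNF nL; rewrite in_setD in_setI in_setD nred_c' => /andP[nF Tc'].
rewrite Tc' /= in nF; apply: liveI; last by rewrite (negPf nred_c') Tc'.
by apply: posE; rewrite (negPf nred_c') (negPf nF).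
Qed.

(** A neighbourhood of a spanning tree is a disc with one boundary circle: no crossing separates,
    and the diagram is connected. *)
Lemma tree_circle x y : circle D (state_of D T) x = circle D (state_of D T) y.
Proof.
have nsep c : ~~ separates D (state_of D T) c.
  have [Tc|nTc] := boolP (c \in T); first by rewrite separates_in // negbK tree_bridge.
  by rewrite separates_notin // negbK; apply/tree_spanning/(linked_ends joinsE); rewrite inE.
pose P d := circle D (state_of D T) x == circle D (state_of D T) d.
apply/eqP; apply: (connect_preserves (P := P) _ (diagram_connected D x y)); rewrite /P //.
move=> {}y z /eqP-> /orP[] /eqP->; first by rewrite circle_arc.
case: y => [[c k]|b]; last by rewrite -(circle_partner D _ (inr b)).
have E02 := nsep c; rewrite negbK in E02.
by case: (crossing_circles D (state_of D T) c k) => ->;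
   case: (crossing_circles D (state_of D T) c (k + 1)) => /= ->; rewrite // eq_sym.
Qed.

(** Connectedness of G(T): the state of [T] has one circle and differs from the oriented state only
    at the edges of [tree_live]. *)
Lemma live_linked x y :
  linked (circle_joins D seifert) tree_live (circle D seifert x) (circle D seifert y).
Proof.
apply: (linked_circles tree_live_agree); rewrite -circle_eq; exact/eqP/tree_circle.
Qed.

(** * Activities of the edges and the labels of the Seifert circles *)

Variable le : rel 'I_n.
Hypothesis le_pres : orientation_preserving_order D T le.

Lemma order_refl e : le e e.
Proof. by case: le_pres => _ _ tot _; have := tot e e; rewrite orbb. Qed.

Lemma order_class e f : (edge_class D T e < edge_class D T f)%N -> le e f.
Proof. by case: le_pres => _ _ _; apply. Qed.

Lemma order_class_gt e f : (edge_class D T f < edge_class D T e)%N -> ~~ le e f.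
Proof.
move=> lt_fe; apply/negP=> le_ef; case: le_pres => anti _ _ _.
have E : e = f by apply: anti; rewrite le_ef order_class.
by rewrite E ltnn in lt_fe.
Qed.

Lemma edge_classE e : edge_class D T e =
  if e \in red then (if e \in T then 2 else 0)%N else (if e \in T then 1 else 3)%N.
Proof. by rewrite /edge_class; case: (e \in red); case: (e \in T). Qed.

Lemma red_notin_externally_live e : e \in red -> e \notin T -> externally_live D T le e.
Proof.
move=> red_e nTe; rewrite /externally_live nTe; apply/forallP=> f; apply/implyP.
rewrite inE => /existsP[C /and3P[_ sC Cf]].
have := subsetP sC f Cf; rewrite in_setU1 => /orP[/eqP->|Tf]; first exact: order_refl.
by apply: order_class; rewrite !edge_classE red_e (negPf nTe) Tf; case: ifP.
Qed.

Lemma spanning_connected_end e (H : {set 'I_n}) :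
  spanning_connected (tait_vertices D) tait H -> linked tait H (end0 e) (end2 e).
Proof.
move=> /forallP/(_ (end0 e))/implyP/(_ (black_region_of_in _ _))/forallP/(_ (end2 e))/implyP.
by apply; apply: black_region_of_in.
Qed.

(** No red edge reconnects [T :\ e], since red edges of [T] already link its ends. Apart from [e],
    the cut thus consists of black edges outside [T], the last class. *)
Lemma black_in_internally_live e : e \notin red -> e \in T -> internally_live D T le e.
Proof.
move=> nred Te; rewrite /internally_live Te; apply/forallP=> f; apply/implyP.
rewrite inE => /(spanning_connected_end e) conn.
have := tree_bridge Te; rewrite /bridge => Tbr.
have [->|f'e] := eqVneq f e; first exact: order_refl.
have Hf: ~~ linked tait (T :\ e) (end0 f) (end2 f).
  apply: contra Tbr => Hf; apply: (linked_sub_rel joinsE) conn => g.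
  by rewrite in_setU1 => /orP[/eqP->//|]; apply: linked_ends.
apply: order_class; rewrite !edge_classE (negPf nred) Te.
have [redf|nredf] := boolP (f \in red); case: ifP => // Tf; case/negP: Hf; last first.
  by apply: (linked_ends joinsE); rewrite in_setD1 f'e.
apply: (linkedS joinsE) (tree_red_linked redf); apply/subsetP=> g /setIP[Tg redg].
by rewrite in_setD1 Tg andbT; apply: contraNneq nred => <-.
Qed.

(** As [e] is no bridge of the red subgraph, some other red edge [f] must have its ends unlinked in
    [T :\ e]. It lies outside [T], hence in the first class, and reconnects [T :\ e]. *)
Lemma red_in_internally_dead e : e \in red -> e \in T -> ~~ internally_live D T le e.
Proof.
move=> red_e Te; rewrite /internally_live Te /=; have Tbr := tree_bridge Te.
have [f redf nlf] : exists2 f, f \in red :\ e & ~~ linked tait (T :\ e) (end0 f) (end2 f).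
  apply/exists_inP; apply: contraR Tbr; rewrite negb_exists_in => /forall_inP allf.
  have := red_bridgeless red_e; rewrite negbK.
  by apply: (linked_sub_rel joinsE) => f /allf; rewrite negbK.
have [f'e red_f] : f != e /\ f \in red by move: redf; rewrite in_setD1 => /andP[].
have nTf : f \notin T.
  by apply: contra nlf => Tf; apply: (linked_ends joinsE); rewrite in_setD1 f'e.
apply/forallPn; exists f; rewrite negb_imply order_class_gt ?andbT; last first.
  by rewrite !edge_classE red_e red_f Te (negPf nTf).
rewrite inE; apply: tait_spanning_connected => u v /tree_spanning.
apply: (linked_sub_rel joinsE) => g Tg; have [->|g'e] := eqVneq g e; last first.
  by apply: (linked_ends joinsE); rewrite !in_setU1 in_setD1 g'e Tg orbT.
have := linked_ends joinsE (setU11 f (T :\ e)).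
have : linked tait T (end0 f) (end2 f) by apply: tree_spanning; apply: (linked_ends joinsE); rewrite inE.
rewrite -{1}(setD1K Te) (linked_setU1 joinsE) (negPf nlf) /=.
have sTf : T :\ e \subset f |: T :\ e by apply: subsetUr.
have sym := linked_sym joinsE.
case/orP=> /andP[/(linkedS joinsE sTf) L1 /(linkedS joinsE sTf) L2] Lf.
  rewrite sym in L1; rewrite sym in L2.
  exact: linked_trans L1 (linked_trans Lf L2).
rewrite sym in Lf; exact: linked_trans L2 (linked_trans Lf L1).
Qed.

(** The ends of [e] lie in different red components, so its cycle contains a black edge of [T],
    which precedes [e]. *)
Lemma black_notin_externally_dead e :
  e \notin red -> e \notin T -> ~~ externally_live D T le e.
Proof.
move=> nred nTe; rewrite /externally_live nTe /=.
have nRe := black_joins_components nred.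
have e02 : end0 e != end2 e by apply: contraNneq nRe => ->; apply: linked_refl.
have Te : linked tait T (end0 e) (end2 e).
  by apply: tree_spanning; apply: (linked_ends joinsE); rewrite inE.
have [C [cycC sCT Ce]] := cycle_exists joinsE nTe e02 Te.
have [f Cf nredf] : exists2 f, f \in C & f \notin red.
  apply/exists_inP; apply: contraR nRe; rewrite negb_exists_in => /forall_inP allred.
  by apply: (linkedS joinsE) Ce; apply/subsetP=> f /allred; rewrite negbK.
have Tf := subsetP sCT f Cf.
apply/forallPn; exists f; rewrite negb_imply order_class_gt ?andbT; last first.
  by rewrite !edge_classE (negPf nred) (negPf nredf) Tf (negPf nTe).
by rewrite inE; apply/existsP; exists (e |: C); rewrite cycC setUS //= in_setU1 Cf orbT.
Qed.

Lemma Hc_red : Hc D T le = red.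
Proof.
apply/setP=> e; rewrite in_set; have [Te|nTe] := boolP (e \in T).
  rewrite /externally_live Te /= orbF; have [rede|nrede] := boolP (e \in red).
    exact: red_in_internally_dead.
  by rewrite black_in_internally_live.
have [rede|nrede] := boolP (e \in red); first exact: red_notin_externally_live.
by rewrite /= (negPf (black_notin_externally_dead nrede nTe)).
Qed.

Lemma live_edgesE : live_edges D T le = tree_live.
Proof.
apply/setP=> e; rewrite in_set in_setU !in_setD; have [Te|nTe] := boolP (e \in T).
  rewrite /externally_live Te /= orbF andbT; have [rede|nrede] := boolP (e \in red).
    by rewrite (negPf (red_in_internally_dead rede Te)).
  by rewrite black_in_internally_live.
rewrite /internally_live (negPf nTe) /= andbF orbF.
have [rede|nrede] := boolP (e \in red); first by rewrite red_notin_externally_live.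
by rewrite (negPf (black_notin_externally_dead nrede nTe)).
Qed.

(** At a positive crossing red edges are positive and black edges negative, so a live edge there
    carries one of the two letters that give x. *)
Lemma positive_live_letter e : e \in positive_live ->
  letter_Lbar D T le e || letter_l D T le e.
Proof.
rewrite in_setD mem_seifert negbK => /andP[pe].
rewrite in_setU !in_setD => /orP[/andP[nTe rede]|/andP[nrede Te]].
  by rewrite /letter_l red_notin_externally_live // -red_positive_edge // rede orbT.
by rewrite /letter_Lbar black_in_internally_live //= in_setC -red_positive_edge // nrede.
Qed.

Lemma faces_Hc : faces D (Hc D T le) = circles D seifert.
Proof. by rewrite /faces Hc_red state_of_red. Qed.

Lemma circle_joins_GT e v w : circle_joins D seifert e v w -> GT_joins D T le e v w.
Proof.
have sep := separates_seifert e; have := sep; rewrite /separates => p'q joins_vw.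
pose Hc' := if e \in red then red :\ e else e |: red.
have fl : flip_at e red Hc'.
  rewrite /Hc'; case: ifP => rede; last by apply: flip_at_setU1; rewrite rede.
  by apply: flip_at_sym; rewrite -{2}(setD1K rede); apply: flip_at_setU1; rewrite setD11.
have sepr : separates D (state_of D red) e by rewrite state_of_red.
have [_] := circles_merge (flip_state_of D fl) sepr; rewrite state_of_red.
move=> /setP/(_ (circle_end0 D seifert e :|: circle_end2 D seifert e)).
rewrite in_set1 eqxx in_setD => /andP[_].
rewrite /GT_joins faces_Hc /faces Hc_red -/Hc' => pq.
case/orP: joins_vw => /andP[/eqP-> /eqP->].
  by rewrite !circle_in p'q.
by rewrite !circle_in eq_sym p'q setUC.
Qed.

(** By [towards_root_class], of two circles in one class at least one starts its way to the root
    with a positive live edge, and is therefore labelled x. *)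
Lemma eps_c_x_class v v' : v \in circles D seifert -> v' \in circles D seifert ->
  linked (circle_joins D seifert) (~: seifert) v v' ->
  v \notin eps_c_x D T le -> v' \notin eps_c_x D T le -> v = v'.
Proof.
move=> Cv Cv' Lvv' Xv Xv'; apply/eqP; apply: contraT => v'v.
have Lp : linked (circle_joins D seifert) positive_live v v'.
  apply: (linked_sub_rel (circle_joinsE D seifert)) Lvv' => e.
  by rewrite in_setC; apply: positive_live_linked.
pose root := GT_root D T le.
have rootE : root = circle D seifert (dot_dart n true) by rewrite /root /GT_root Hc_red state_of_red.
have Lroot : linked (circle_joins D seifert) tree_live v root.
  by case/circlesP: Cv => x ->; rewrite rootE; apply: live_linked.
have sLp : positive_live \subset tree_live by apply: subsetDl.
have [u [e [w [uvv' u'root Le joins_uw Lw]]]] :=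
  towards_root_class (circle_joinsE D seifert) sLp Lroot Lp v'v.
have: u \in eps_c_x D T le.
  rewrite in_set faces_Hc; apply/and3P; split=> //; first by case/orP: uvv' => /eqP->.
  apply/existsP; exists e; rewrite positive_live_letter // andbT /towards_root.
  rewrite live_edgesE (subsetP sLp) //=; apply/existsP; exists w.
  rewrite circle_joins_GT //=; pose P z := linked (GT_joins D T le) (tree_live :\ e) w z.
  apply: (connect_preserves (P := P) _ Lw); last exact: linked_refl.
  move=> x y Lx /existsP[f /andP[Lf fxy]]; apply: linked_trans Lx _.
  by apply: (linked_joins Lf); apply: circle_joins_GT.
by case/orP: uvv' => /eqP->; rewrite ?(negPf Xv) ?(negPf Xv').
Qed.

Lemma j_plusE : j_plus D T le = j_grading D seifert (eps_c_x D T le).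
Proof. by rewrite /j_plus Hc_red state_of_red. Qed.

Lemma eps_c_x_sub : eps_c_x D T le \subset circles D seifert.
Proof. by apply/subsetP=> v; rewrite in_set faces_Hc => /andP[]. Qed.

End Tree.
End Seifert.

(** * The Lee differential in the basis of circle colourings *)

Lemma sum_anti_involution (I : finType) (F : I -> rat) (h : I -> I) :
  involutive h -> (forall i, F (h i) = - F i) -> \sum_i F i = 0.
Proof.
move=> hK Fh; apply/eqP; rewrite -eqNr -sumrN; apply/eqP.
by rewrite [RHS](reindex_inj (inv_inj hK)); apply: eq_bigr => i _; rewrite Fh.
Qed.

Lemma sum_subset_setU1 (I : finType) (x : I) (A : {set I}) (F : {set I} -> rat) : x \notin A ->
  \sum_(Y : {set I} | Y \subset x |: A) F Y = \sum_(Y : {set I} | Y \subset A) (F Y + F (x |: Y)).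
Proof.
move=> nAx; rewrite (bigID (fun Y : {set I} => x \in Y)) /= addrC big_split /=; congr (_ + _).
  apply: eq_bigl => Y; apply/andP/idP => [[sY nYx]|sY].
    apply/subsetP=> y Yy; have := subsetP sY y Yy; rewrite in_setU1 => /orP[/eqP Dy|//].
    by rewrite -Dy Yy in nYx.
  by rewrite (subset_trans sY) ?subsetUr //; split=> //; apply: contra nAx; apply: (subsetP sY).
rewrite (reindex_onto (fun Y => x |: Y) (fun Y => Y :\ x)) /=; last first.
  by move=> Y /andP[_]; apply: setD1K.
apply: eq_bigl => Y; rewrite setU11 andbT; apply/andP/idP => [[sY /eqP DY]|sY].
  apply/subsetP=> y Yy; have := subsetP sY y; rewrite !in_setU1 Yy orbT => /(_ isT) /orP[/eqP Dy|//].
  by move: Yy; rewrite -DY Dy setD11.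
have nYx : x \notin Y by apply: contra nAx; apply: (subsetP sY).
by rewrite setUS // setU1K.
Qed.

Lemma sum_subset0 (I : finType) (F : {set I} -> rat) :
  \sum_(Y : {set I} | Y \subset set0) F Y = F set0.
Proof. by rewrite (big_pred1 set0) // => Y; rewrite subset0. Qed.

Section Coloring.
Variables (n : nat) (D : diagram n).
Implicit Types (S : {set 'I_n}) (c : 'I_n) (d x y : dart n) (s : dart n -> bool).
Implicit Types (X Y : {set {set dart n}}).

(** A colouring of the circles of [S], given on darts so that different states can share it. *)
Definition compatible S s :=
  [forall d, (s (arc D d) == s d) && (s (partner S d) == s d)].

Definition circle_sign s (C : {set dart n}) : rat := (-1) ^+ [exists d in C, s d].

Lemma circle_sign_sqr s C : circle_sign s C * circle_sign s C = 1.
Proof. by rewrite -expr2 sqrr_sign. Qed.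

Lemma compatibleP S s :
  reflect ((forall d, s (arc D d) = s d) /\ (forall d, s (partner S d) = s d)) (compatible S s).
Proof.
apply: (iffP forallP) => [sS|[sarc spartner] d]; last by rewrite sarc spartner !eqxx.
by split=> d; have /andP[/eqP? /eqP?] := sS d.
Qed.

Lemma circle_signE S s x : compatible S s -> circle_sign s (circle D S x) = (-1) ^+ s x.
Proof.
case/compatibleP=> sarc spartner; congr (_ ^+ nat_of_bool _).
apply/exists_inP/idP => [[y xy]|sx]; last by exists x; rewrite ?circle_refl.
by rewrite (circle_const sarc spartner xy).
Qed.

Lemma compatible_flip c S S' s : flip_at c S S' -> compatible S' s ->
  compatible S s = (s (crossing_dart c 0) == s (crossing_dart c 2%:R)).
Proof.
move=> fl /compatibleP[sarc sp'].
have flc := fl c; rewrite eqxx addTb in flc.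
have q0 := sp' (crossing_dart c 0); have q2 := sp' (crossing_dart c 2%:R).
rewrite /= flc in q0 q2.
apply/compatibleP/eqP => [[_ sp]|s02].
  have p0 := sp (crossing_dart c 0); have p2 := sp (crossing_dart c 2%:R).
  move: p0 p2 q0 q2; rewrite /=; case: (c \in S); rewrite /= ?(ord4_succ, ord4_pred) => //.
    by move=> p0 p2 q0 q2; rewrite -q0 p2.
  by move=> p0 p2 q0 q2; rewrite -p0 q2.
split=> // -[[c' k]|b]; last exact: (sp' (inr b)).
have [->|c'c] := eqVneq c' c; last first.
  have -> : partner S (inl (c', k)) = partner S' (inl (c', k)).
    by apply: partner_agree; rewrite fl (negPf c'c).
  exact: sp'.
move: q0 q2 s02; rewrite /=; case: (c \in S); elim/ord4P: k;
  rewrite /= ?(ord4_succ, ord4_pred) => q0 q2 s02; by rewrite ?q0 ?q2 ?s02 // -q0 ?s02 -?q2.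
Qed.

Lemma compatible_merge c S S' s : flip_at c S S' -> compatible S' s ->
  separates D S c -> compatible S s.
Proof.
move=> fl sS' sep; rewrite (compatible_flip fl sS'); apply/eqP.
have [_ nsep] := circle_flip D fl; rewrite sep in nsep.
case/compatibleP: sS' => sarc sp; apply: (circle_const sarc sp).
by rewrite -circle_eq; apply: negbFE; exact: nsep.
Qed.

(** Let a = x + 1 on circles coloured [false] and b = x - 1 on those coloured [true]. Up to a power
    of 2 this functional is the coefficient of the tensor product of these factors; its values are
    also the coefficients of that product in the basis of labels. *)
Definition coloring_form S s (e : enhanced_state D) : rat :=
  if (val e).1 == S then \prod_(C in circles D S :\: (val e).2) circle_sign s C else 0.

(** From a a = 2 a, b b = -2 b and a b = 0 for merges, and from a to a * a and b to b * b for
    splits, in the normalisation of [coloring_form]. *)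
Definition edge_factor S c s : rat :=
  if separates D S c then (-1) ^+ s (crossing_dart c 0) else 2%:R.

Lemma local_merge s (p q r : {set dart n}) X (t : rat) : p != q -> t * t = 1 ->
  circle_sign s p = t -> circle_sign s q = t -> circle_sign s r = t ->
  \sum_(Y : {set {set dart n}} | Y \subset [set r])
     (if merge_coef #|X :&: [set p; q]| #|Y| then \prod_(C in [set r] :\: Y) circle_sign s C else 0)
  = t * \prod_(C in [set p; q] :\: X) circle_sign s C.
Proof.
move=> p'q tt sp sq sr; rewrite -[[set r]]setU0 sum_subset_setU1 ?inE // sum_subset0 setU0 cards0 cards1.
rewrite setDv setD0 big_set0 big_set1 sr.
have -> : \prod_(C in [set p; q] :\: X) circle_sign s C = t ^+ #|[set p; q] :\: X|.
  by rewrite -prodr_const; apply: eq_bigr => C; rewrite in_setD in_set2 => /andP[_ /orP[] /eqP->].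
have := cardsID X [set p; q]; rewrite cards2 p'q setIC.
move: #|_ :&: _| #|_ :\: _| => k m; case: k => [|[|[|k]]]; case: m => [|[|[|m]]] //= _;
  rewrite /merge_coef /= ?addr0 ?add0r ?expr0 ?expr1 ?expr2 ?mulr1 ?mulrA ?tt ?mul1r //.
Qed.

Lemma local_split s (p q r : {set dart n}) X : p != q ->
  \sum_(Y : {set {set dart n}} | Y \subset [set p; q])
     (if split_coef #|X :&: [set r]| #|Y| then \prod_(C in [set p; q] :\: Y) circle_sign s C else 0)
  = if r \in X then 1 + circle_sign s p * circle_sign s q else circle_sign s p + circle_sign s q.
Proof.
move=> p'q; rewrite sum_subset_setU1 ?inE // -[[set q]]setU0 sum_subset_setU1 ?inE // sum_subset0 !setU0.
rewrite cards0 !cards1 cards2 p'q setDv setD0 big_set0.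
have -> : [set p; q] :\: [set q] = [set p].
  by apply/setP=> C; rewrite !inE; case: (eqVneq C q) => [->|_] /=; rewrite ?orbF // eq_sym (negPf p'q).
have -> : [set p; q] :\: [set p] = [set q].
  by apply/setP=> C; rewrite !inE; case: (eqVneq C p) => [->|_] //=; rewrite (negPf p'q).
rewrite !big_set1 big_setU1 ?inE // big_set1 setIC.
have [Xr|nXr] := boolP (r \in X).
  have -> : [set r] :&: X = [set r] by apply/setIidPl; rewrite sub1set.
  by rewrite cards1 /split_coef /= !addr0 add0r addrC.
have -> : [set r] :&: X = set0 by apply/setP=> C; rewrite !inE; case: eqVneq => // ->; apply/negbTE.
by rewrite cards0 /split_coef /= add0r addr0 addrC.
Qed.

End Coloring.

Section Differential.
Variables (n : nat) (D : diagram n).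
Implicit Types (S : {set 'I_n}) (c : 'I_n) (d x y : dart n) (s : dart n -> bool).
Implicit Types (X Y : {set {set dart n}}) (e : enhanced_state D).

Lemma edge_coefE e e' c (S := (val e).1) (X := (val e).2) (S' := (val e').1) (X' := (val e').2)
    (old := circles D S :\: circles D S') (new := circles D S' :\: circles D S) :
  edge_coef e e' c = [&& c \notin S, S' == c |: S, X :\: old == X' :\: new &
      if (#|new| < #|old|)%N then merge_coef #|X :&: old| #|X' :&: new|
      else split_coef #|X :&: old| #|X' :&: new|].
Proof.
by rewrite /edge_coef; case: e @S @X @old @new => [[S1 X1] h1]; case: e' @S' @X' => [[S2 X2] h2].
Qed.

Definition local_coef S c (k m : nat) :=
  if separates D S c then merge_coef k m else split_coef k m.

(** The size comparison in [edge_coef] therefore does tell merges from splits. *)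
Lemma card_old_new S c : c \notin S ->
  (#|circles D (c |: S) :\: circles D S| < #|circles D S :\: circles D (c |: S)|)%N
  = separates D S c.
Proof.
move=> nSc; have fl := flip_at_setU1 nSc; have [sep|nsep] := boolP (separates D S c).
  have [-> ->] := circles_merge fl sep; rewrite cards1 cards2.
  by move: sep; rewrite /separates => ->.
have sep' : separates D (c |: S) c by rewrite (circle_flip D fl).2.
have [-> ->] := circles_merge (flip_at_sym fl) sep'; rewrite cards1 cards2.
by move: sep'; rewrite /separates => ->.
Qed.

(* The targets of [e] along [c] are determined by the set [Y] of the new
   circles labelled [x]. *)
Lemma edge_sum_subsets S X (sX : X \subset circles D S) c (f : {set {set dart n}} -> rat)
    (e : enhanced_state D) (old := circles D S :\: circles D (c |: S))
    (new := circles D (c |: S) :\: circles D S) :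
  val e = (S, X) -> c \notin S ->
  \sum_(e' | edge_coef e e' c) f (val e').2
  = \sum_(Y : {set {set dart n}} | Y \subset new)
      if local_coef S c #|X :&: old| #|Y| then f ((X :\: old) :|: Y) else 0.
Proof.
move=> De nSc.
have common C : C \in X :\: old -> (C \in circles D (c |: S)) && (C \in circles D S).
  rewrite !in_setD negb_and => /andP[nold XC]; have CS := subsetP sX C XC.
  by rewrite CS orbF negbK in nold; rewrite nold CS.
have sub Y : Y \subset new -> (X :\: old) :|: Y \subset circles D (c |: S).
  move=> sY; rewrite subUset (subset_trans sY) ?subsetDl // andbT.
  by apply/subsetP=> C /common/andP[].
(* The default [e] is not reached when [Y] is a set of new circles. *)
pose mk Y : enhanced_state D := insubd e (c |: S, (X :\: old) :|: Y).
have valmk Y : Y \subset new -> val (mk Y) = (c |: S, (X :\: old) :|: Y).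
  by move=> sY; rewrite insubdK // -topredE /= sub.
have XoldI Y : Y \subset new ->
  ((X :\: old) :|: Y) :&: new = Y /\ ((X :\: old) :|: Y) :\: new = X :\: old.
  move=> sY; split; apply/setP=> C.
    rewrite in_setI in_setU; have [YC|nYC] := boolP (C \in Y); first by rewrite orbT (subsetP sY).
    by rewrite orbF; apply/andP=> -[/common/andP[C1 C2]]; rewrite in_setD C2.
  rewrite [LHS]in_setD in_setU; have [XC|nXC] /= := boolP (C \in X :\: old).
    by rewrite in_setD; have /andP[-> ->] := common C XC.
  by apply/andP=> -[nC /(subsetP sY)]; rewrite (negPf nC).
have mk_edge Y : Y \subset new -> edge_coef e (mk Y) c = local_coef S c #|X :&: old| #|Y|.
  move=> sY; rewrite edge_coefE valmk // De /= nSc eqxx -/old -/new.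
  by have [-> ->] := XoldI Y sY; rewrite eqxx card_old_new.
rewrite -big_mkcondr /=.
rewrite (reindex_onto mk (fun e' => (val e').2 :&: new)) /=; last first.
  move=> e'; rewrite edge_coefE De /= => /and4P[_ /eqP DS' /eqP DX _]; apply: val_inj.
  rewrite valmk ?subsetIr //; rewrite DS' -/old -/new in DX.
  by rewrite DX [_ :\: _ :|: _]setUC setID -DS' -surjective_pairing.
have memE Y : (edge_coef e (mk Y) c && ((val (mk Y)).2 :&: new == Y))
    = (Y \subset new) && local_coef S c #|X :&: old| #|Y|.
  have [sY|nsY] := boolP (Y \subset new).
    by rewrite mk_edge // valmk // (XoldI Y sY).1 eqxx andbT.
  by apply/andP=> -[_ /eqP DY]; rewrite -DY subsetIr in nsY.
by apply: eq_big => [Y|Y]; rewrite memE // => /andP[sY _]; rewrite valmk.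
Qed.

Lemma prod_split_common S S' X s (old := circles D S :\: circles D S')
    (new := circles D S' :\: circles D S) Y : X \subset circles D S -> Y \subset new ->
  \prod_(C in circles D S' :\: ((X :\: old) :|: Y)) circle_sign s C
  = \prod_(C in (circles D S :&: circles D S') :\: X) circle_sign s C
    * \prod_(C in new :\: Y) circle_sign s C.
Proof.
move=> sX sY; rewrite (big_setID (circles D S)) /=.
by congr (_ * _); apply: eq_bigl => C; rewrite !(in_setD, in_setI, in_setU) !(negb_or, negb_and);
  have := subsetP sX C; have := subsetP sY C; rewrite in_setD;
  case: (C \in X) => //=; case: (C \in Y) => //=; case: (C \in circles D S) => //=;
  case: (C \in circles D S') => //= h1 h2; first [by move: (h1 isT) | by move: (h2 isT)].
Qed.

(** The transposed edge map keeps the colouring: it multiplies the functional by a scalar, or kills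
    it when the colouring does not descend to the earlier state. *)
Lemma edge_coloring_form e c S' s : compatible D S' s ->
  \sum_(e' | edge_coef e e' c) coloring_form S' s e'
  = if (c \in S') && compatible D (S' :\ c) s
    then edge_factor D (S' :\ c) c s * coloring_form (S' :\ c) s e else 0.
Proof.
move=> sS'; have [/andP[S'c /eqP DS]|far] := boolP ((c \in S') && ((val e).1 == S' :\ c)); last first.
  rewrite big1 => [|e']; last first.
    rewrite edge_coefE => /and4P[nec /eqP De' _ _]; rewrite /coloring_form; case: eqP => // DS'.
    by case/negP: far; rewrite -DS' De' setU11 setU1K /=.
  case: ifP => // /andP[c_in _]; rewrite c_in /= in far.
  by rewrite /coloring_form (negPf far) mulr0.
have [S nSc DS'] : exists2 S : {set 'I_n}, c \notin S & S' = c |: S.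
  by exists (S' :\ c); rewrite ?setD11 ?setD1K.
subst S'; rewrite S'c setU1K // in DS *.
set X := (val e).2; have De : val e = (S, X) by rewrite -DS -surjective_pairing.
have sX : X \subset circles D S by have := valP e; rewrite /= -/X DS.
pose f X' := \prod_(C in circles D (c |: S) :\: X') circle_sign s C.
rewrite (eq_bigr (fun e' => f (val e').2)); last first.
  by move=> e'; rewrite edge_coefE De => /and4P[_ /eqP De' _ _]; rewrite /coloring_form De' eqxx.
rewrite (edge_sum_subsets sX f De nSc).
pose old := circles D S :\: circles D (c |: S); pose new := circles D (c |: S) :\: circles D S.
pose common := \prod_(C in (circles D S :&: circles D (c |: S)) :\: X) circle_sign s C.
rewrite (eq_bigr (fun Y => common * (if local_coef S c #|X :&: old| #|Y| then
    \prod_(C in new :\: Y) circle_sign s C else 0))); last first.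
  by move=> Y sY; rewrite /f prod_split_common //; case: ifP; rewrite ?mulr0.
rewrite -big_distrr /=.
have -> : coloring_form S s e = common * \prod_(C in old :\: X) circle_sign s C.
  rewrite /coloring_form De eqxx /=.
  rewrite (big_setID (circles D (c |: S))) /=.
  by congr (_ * _); apply: eq_bigl => C; rewrite !(in_setD, in_setI); case: (C \in X); rewrite //= andbC.
have fl := flip_at_setU1 nSc; have ff := flip_at_sym fl.
have sgn S1 k : compatible D S1 s ->
    circle_sign s (circle D S1 (crossing_dart c k)) = (-1) ^+ s (crossing_dart c k).
  by move=> sS1; rewrite (circle_signE _ sS1).
have [sep|nsep] := boolP (separates D S c).
  have sS := compatible_merge fl sS' sep; rewrite sS /edge_factor sep mulrCA; congr (_ * _).
  have [Dold Dnew] := circles_merge fl sep; rewrite /local_coef sep /old /new Dold Dnew.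
  have s02 : s (crossing_dart c 0) = s (crossing_dart c 2%:R).
    by apply/eqP; rewrite -(compatible_flip fl sS').
  apply: local_merge; rewrite ?sgn -?s02 //; first by rewrite -expr2 sqrr_sign.
  have [_ nsep'] := circle_flip D fl.
  suff ->: circle D S (crossing_dart c 0) :|: circle D S (crossing_dart c 2%:R)
    = circle D (c |: S) (crossing_dart c 0) by rewrite sgn.
  apply: circle_of; last by rewrite in_setU circle_refl.
  move/setP: Dnew => /(_ (circle D S (crossing_dart c 0) :|: circle D S (crossing_dart c 2%:R))).
  by rewrite set11 in_setD => /andP[].
have sep' : separates D (c |: S) c by rewrite (circle_flip D fl).2.
have [Dnew Dold] := circles_merge ff sep'.
rewrite /local_coef (negPf nsep) /old /new Dold Dnew local_split; last exact: sep'.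
rewrite !sgn // (compatible_flip fl sS') /edge_factor (negPf nsep).
set r := _ :|: _; have rS : r \in circles D S.
  by move/setP/(_ r): Dold; rewrite set11 in_setD => /andP[].
have r0 : crossing_dart c 0 \in r by rewrite in_setU circle_refl.
(* A split yields equal colours only: if the two signs differ, both values in [local_split]
   vanish. *)
have [s02|s02] := eqVneq (s (crossing_dart c 0)) (s (crossing_dart c 2%:R)); last first.
  case: ifP => _; case: (s (crossing_dart c 0)) s02; case: (s (crossing_dart c 2%:R)) => //= _;
  by rewrite ?expr0 ?expr1 ?mulr1 ?mul1r ?subrr ?addNr mulr0.
have sS : compatible D S s by rewrite (compatible_flip fl sS') s02.
have sr : circle_sign s r = (-1) ^+ s (crossing_dart c 0) by rewrite (circle_of rS r0) sgn.
rewrite -s02 mulrCA; congr (_ * _); have [Xr|nXr] := boolP (r \in X).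
  have -> : [set r] :\: X = set0 by apply/eqP; rewrite setD_eq0 sub1set.
  by rewrite big_set0 mulr1 -expr2 sqrr_sign.
have -> : [set r] :\: X = [set r] by apply/setDidPl; rewrite disjoints1.
by rewrite big_set1 sr mulr_natl mulr2n.
Qed.

End Differential.

(** * The square of the Lee differential *)

Section Square.
Variables (n : nat) (D : diagram n).
Implicit Types (S : {set 'I_n}) (c : 'I_n) (d x y : dart n) (s : dart n -> bool).
Implicit Types (X Y : {set {set dart n}}) (e : enhanced_state D).

Definition covector (f : enhanced_state D -> rat) : 'cV[rat]_#|enhanced_state D| :=
  \col_a f (enum_val a).

Lemma row_covector (v : enhanced_state D -> rat) (f : enhanced_state D -> rat) :
  (\row_a v (enum_val a)) *m covector f = (\sum_e v e * f e)%:M.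
Proof.
apply/matrixP=> i j; rewrite !ord1 !mxE eqxx mulr1n.
rewrite [RHS](reindex (@enum_val (enhanced_state D) predT)) /=; last first.
  by apply: onW_bij; apply: enum_val_bij.
by apply: eq_bigr => a _; rewrite !mxE.
Qed.

Definition count_below S c := #|[set c' in S | (c' < c)%N]|.

Lemma count_belowD1 S c b : b \in S -> count_below S c = ((b < c) + count_below (S :\ b) c)%N.
Proof.
move=> Sb; rewrite /count_below (cardsD1 b [set c' in S | _]) inE Sb /=; congr (_ + _)%N.
by apply: eq_card => c'; rewrite !inE andbA.
Qed.

Definition weight S s c : rat :=
  if (c \in S) && compatible D (S :\ c) s
  then (-1) ^+ count_below (S :\ c) c * edge_factor D (S :\ c) c s else 0.

Lemma lee_mx_form S s : compatible D S s ->
  lee_mx D *m covector (coloring_form S s)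
  = \sum_c weight S s c *: covector (coloring_form (S :\ c) s).
Proof.
move=> sS; apply/matrixP=> a j; rewrite summxE !mxE.
set e := enum_val a.
transitivity (\sum_e' lee_coef e e' * coloring_form S s e').
  rewrite [RHS](reindex (@enum_val (enhanced_state D) predT)) /=; last first.
    by apply: onW_bij; apply: enum_val_bij.
  by apply: eq_bigr => b _; rewrite !mxE.
transitivity (\sum_(c < n) (-1) ^+ count_below (val e).1 c *
    \sum_(e' | edge_coef e e' c) coloring_form S s e').
  rewrite /lee_coef; under eq_bigr => e' _ do rewrite big_distrl /= big_mkcond /=.
  rewrite exchange_big /=; apply: eq_bigr => c _.
  by rewrite big_distrr [RHS]big_mkcond /=; apply: eq_bigr => e' _; case: ifP.
apply: eq_bigr => c _; rewrite edge_coloring_form // !mxE -/e /weight.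
case: ifP => _; last by rewrite mulr0 mul0r.
rewrite mulrA /coloring_form; case: eqP => [->//|_]; by rewrite !mulr0.
Qed.

Lemma separates_far c b S S' s : flip_at b S S' -> compatible D S s ->
  s (crossing_dart c 0) = s (crossing_dart c 2%:R) ->
  (forall k, s (crossing_dart b k) != s (crossing_dart c 0)) ->
  separates D S' c = separates D S c.
Proof.
move=> fl /compatibleP[sarc sp] s02 far.
suff E k : s (crossing_dart c k) = s (crossing_dart c 0) ->
    circle D S' (crossing_dart c k) = circle D S (crossing_dart c k).
  by rewrite /separates !E.
move=> sk; apply: (circle_unaffected fl) => m; apply/negP=> /(circle_const sarc sp).
by rewrite sk => /esym/eqP; apply/negP.
Qed.

Lemma color_crossing c S S' s : flip_at c S S' -> compatible D S s -> compatible D S' s ->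
  forall k, s (crossing_dart c k) = s (crossing_dart c 0).
Proof.
move=> fl sS sS' k; have := sS; rewrite (compatible_flip fl sS') => /eqP s02.
case/compatibleP: sS => sarc sp.
by case: (crossing_circles D S c k) => /circle_eqP/(circle_const sarc sp) ->.
Qed.

(** [partner] at a crossing depends only on the smoothing there: the middle state agrees with the
    upper one at [c] and with the lower one elsewhere. *)
Lemma compatible_between S b c s : b != c ->
  compatible D S s -> compatible D (b |: (c |: S)) s -> compatible D (c |: S) s.
Proof.
move=> b'c /compatibleP[sarc sp] /compatibleP[_ sp']; apply/compatibleP; split=> // d.
case: d => [[c' k]|b0]; last exact: (sp (inr b0)).
have [->|c'c] := eqVneq c' c.
  rewrite -[RHS]sp'; congr s; apply: partner_agree.
  by rewrite !in_setU1 eqxx orbT.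
by rewrite -[RHS]sp; congr s; apply: partner_agree; rewrite in_setU1 (negPf c'c).
Qed.

(* Both sides are the product of one factor for each merge among two changes of
   smoothing.  The number of merges is read off from the number of circles; if
   the colours at the two crossings differ, then no circle meets both, so that
   each crossing merges in one order iff it does in the other. *)
Lemma edge_factor_square S b c s : b \notin S -> c \notin S -> b != c ->
  compatible D S s -> compatible D (b |: (c |: S)) s ->
  edge_factor D S c s * edge_factor D (c |: S) b s
  = edge_factor D S b s * edge_factor D (b |: S) c s.
Proof.
move=> nSb nSc b'c sS sSbc.
have nb : b \notin c |: S by rewrite in_setU1 negb_or b'c.
have nc : c \notin b |: S by rewrite in_setU1 negb_or eq_sym b'c.
have swap : b |: (c |: S) = c |: (b |: S) by rewrite !setUA [[set b] :|: _]setUC.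
have sSc := compatible_between b'c sS sSbc.
have sSb : compatible D (b |: S) s by apply: (@compatible_between _ c); rewrite 1?eq_sym // -swap.
have card1 := (circle_flip D (flip_at_setU1 nSc)).1.
have card2 := (circle_flip D (flip_at_setU1 nb)).1.
have card3 := (circle_flip D (flip_at_setU1 nSb)).1.
have card4 := (circle_flip D (flip_at_setU1 nc)).1.
rewrite -swap in card4; rewrite /edge_factor.
have colb := color_crossing (flip_at_setU1 nSb) sS sSb.
have colc := color_crossing (flip_at_setU1 nSc) sS sSc.
have [same|diff] := eqVneq (s (crossing_dart b 0)) (s (crossing_dart c 0)).
  rewrite same; have : (separates D S c + separates D (c |: S) b
      = separates D S b + separates D (b |: S) c)%N.
    move: card1 card2 card3 card4.
    move: #|circles D (b |: (c |: S))| #|circles D (b |: S)| #|circles D (c |: S)| #|circles D S|.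
    move: (separates D S c) (separates D S b) (separates D (b |: S) c) (separates D (c |: S) b).
    by clear; lia.
  move: (separates D S c) (separates D S b) (separates D (b |: S) c) (separates D (c |: S) b).
  by do 4 case => //=; move=> _; rewrite mulrC.
have -> : separates D (b |: S) c = separates D S c.
  by apply: (separates_far (flip_at_setU1 nSb) sS) => [|k]; rewrite ?colb ?colc.
have -> : separates D (c |: S) b = separates D S b.
  by apply: (separates_far (flip_at_setU1 nSc) sS) => [|k]; rewrite ?colb ?colc // eq_sym.
exact: mulrC.
Qed.

Lemma weight_anticommute S s b c : compatible D S s ->
  weight S s c * weight (S :\ c) s b = - (weight S s b * weight (S :\ b) s c).
Proof.
move=> sS; wlog b_lt_c : b c / (b < c)%N.
  move=> IH; have [lt|lt|/val_inj->] := ltngtP b c; first exact: IH.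
    by rewrite (IH _ _ lt) opprK.
  by rewrite /weight setD11 /= mulr0 oppr0.
have b'c : b != c by apply: contraTneq b_lt_c => ->; rewrite ltnn.
rewrite /weight !in_setD1 [c == b]eq_sym b'c /=.
have swap : S :\ b :\ c = S :\ c :\ b by rewrite !setDDl setUC.
rewrite swap; set S0 := S :\ c :\ b.
have [Sc|nSc] := boolP (c \in S); last by rewrite /= mul0r mulr0 oppr0.
have [Sb|nSb] := boolP (b \in S); last by rewrite /= mul0r mulr0 oppr0.
have [sS0|nsS0] := boolP (compatible D S0 s); last by rewrite !mulr0 oppr0.
have nb0 : b \notin S0 by rewrite setD11.
have nc0 : c \notin S0 by rewrite in_setD1 eq_sym b'c setD11.
have DSc : S :\ c = b |: S0 by rewrite setD1K // in_setD1 b'c.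
have DSb : S :\ b = c |: S0 by rewrite /S0 -swap setD1K // in_setD1 eq_sym b'c.
have DS : S = b |: (c |: S0) by rewrite -DSb setD1K.
have DS' : S = c |: (b |: S0) by rewrite -DSc setD1K.
rewrite DSc DSb (compatible_between b'c sS0) -?DS // (@compatible_between S0 c b s) 1?eq_sym -?DS' //=.
(* The sign: since [b] precedes [c], adding [b] raises the count below [c] by one, whereas adding
   [c] does not affect the count below [b]. *)
rewrite [count_below (b |: S0) c](count_belowD1 _ (b := b)) ?setU11 // b_lt_c setU1K //.
rewrite [count_below (c |: S0) b](count_belowD1 _ (b := c)) ?setU11 // ltnNge (ltnW b_lt_c) setU1K //.
rewrite add1n add0n exprS mulN1r mulrACA [in RHS]mulrACA.
rewrite !mulNr; congr (- _); rewrite [_ ^+ _ * _ ^+ count_below S0 b]mulrC; congr (_ * _).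
by rewrite mulrC [RHS]mulrC; apply/esym/edge_factor_square; rewrite -?DS.
Qed.

Lemma lee_sq_form S s : compatible D S s ->
  lee_mx D *m (lee_mx D *m covector (coloring_form S s)) = 0.
Proof.
move=> sS; rewrite lee_mx_form // mulmx_sumr.
pose F c b := (weight S s c * weight (S :\ c) s b) *: covector (coloring_form (S :\ c :\ b) s).
have F_anti c b : F b c = - F c b.
  rewrite /F (weight_anticommute c b sS) scaleNr.
  by have -> : S :\ b :\ c = S :\ c :\ b by rewrite !setDDl setUC.
have -> : \sum_c lee_mx D *m (weight S s c *: covector (coloring_form (S :\ c) s))
    = \sum_c \sum_b F c b.
  apply: eq_bigr => c _; rewrite -scalemxAr /F.
  have [sc|nsc] := boolP (compatible D (S :\ c) s).
    by rewrite lee_mx_form // scaler_sumr; apply: eq_bigr => b _; rewrite scalerA.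
  rewrite /weight (negPf nsc) andbF scale0r big1 // => b _.
  by rewrite mul0r scale0r.
apply/matrixP=> i j; rewrite pair_big /= summxE [RHS]mxE.
pose h (p : 'I_n * 'I_n) := (p.2, p.1).
by apply: (@sum_anti_involution _ _ h) => [[]|[c b]] //=; rewrite F_anti mxE.
Qed.

(* The colorings of [S] are the sets [A] of circles coloured [true]; summing
   over them with suitable signs isolates a single enhanced state. *)
Lemma coloring_forms_separate m (M : 'M[rat]_(m, #|enhanced_state D|)) :
  (forall S s, compatible D S s -> M *m covector (coloring_form S s) = 0) -> M = 0.
Proof.
move=> M0; pose col (S : {set 'I_n}) (A : {set {set dart n}}) d := circle D S d \in A.
have colS S A : compatible D S (col S A).
  by apply/compatibleP; split=> d; rewrite /col ?circle_arc ?circle_partner.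
have signE S A C : C \in circles D S -> circle_sign (col S A) C = (-1) ^+ (C \in A).
  by case/circlesP=> x ->; rewrite (circle_signE _ (colS S A)).
have delta e : M *m covector (fun e' => (e' == e)%:R) = 0.
  pose S := (val e).1; pose X := (val e).2.
  pose a A : rat := \prod_(C in circles D S :\: X) circle_sign (col S A) C.
  (* [A] ranges over all sets of sets of darts, not only over sets of circles of [S], and each of
     them contributes 1 at [e]. *)
  pose N : rat := #|{: {set {set dart n}}}|%:R.
  have N0 : N != 0 by rewrite pnatr_eq0 -lt0n; apply/card_gt0P; exists set0.
  apply: (scalerI N0); rewrite scaler0.
  have -> : N *: (M *m covector (fun e' => (e' == e)%:R))
      = \sum_A a A *: (M *m covector (coloring_form S (col S A))).
    rewrite scalemxAr; under [RHS]eq_bigr => A _ do rewrite scalemxAr.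
    rewrite -mulmx_sumr; congr (M *m _); apply/matrixP=> i j; rewrite summxE !mxE.
    set e' := enum_val i; under [RHS]eq_bigr => A _ do rewrite !mxE -/e'.
    have [->|e'e] := eqVneq e' e.
      rewrite mulr1 (eq_bigr (fun=> 1)) ?sumr_const // => A _.
      rewrite /coloring_form eqxx -/X /a -big_split big1 // => C _; exact: circle_sign_sqr.
    rewrite mulr0; apply/esym; rewrite /coloring_form; case: eqP => [De'|_]; last first.
      by rewrite big1 // => A _; rewrite mulr0.
    pose X' := (val e').2.
    have sX : X \subset circles D S by exact: (valP e).
    have sX' : X' \subset circles D S by rewrite -De'; exact: (valP e').
    (* A circle labelled differently in [e] and [e']. Changing its colour reverses exactly one of
       the two signs, so the terms cancel in pairs. *)
    have [C0 C0S XX'] : exists2 C0, C0 \in circles D S & (C0 \in X) != (C0 \in X').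
      apply/exists_inP; apply: contraR e'e; rewrite negb_exists_in => /forall_inP eqX.
      apply/eqP/val_inj; rewrite [val e]surjective_pairing [val e']surjective_pairing -/S -/X -/X' De'.
      congr (_, _); apply/setP=> C; apply/idP/idP => XC.
        by have := eqX C (subsetP sX' C XC); rewrite XC negbK => /eqP.
      by have := eqX C (subsetP sX C XC); rewrite XC negbK => /eqP <-.
    pose h (A : {set {set dart n}}) := [set C | (C == C0) (+) (C \in A)].
    have hK : involutive h by move=> A; apply/setP=> C; rewrite !inE addbA addbb.
    apply: (@sum_anti_involution _ _ h) => // A.
    have prodh Y : Y \subset circles D S ->
       \prod_(C in circles D S :\: Y) circle_sign (col S (h A)) C
        = (-1) ^+ (C0 \notin Y) * \prod_(C in circles D S :\: Y) circle_sign (col S A) C.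
      move=> sY; have sgnh C : C \in circles D S ->
          circle_sign (col S (h A)) C = (-1) ^+ (C == C0) * circle_sign (col S A) C.
        by move=> CS; rewrite !signE // inE signr_addb.
      rewrite (eq_bigr (fun C => (-1) ^+ (C == C0) * circle_sign (col S A) C)); last first.
        by move=> C /setDP[CS _]; apply: sgnh.
      rewrite big_split /=; congr (_ * _); have [YC0|nYC0] /= := boolP (C0 \in Y).
        by rewrite big1 // => C /setDP[_ nY]; case: eqP => // DC; rewrite -DC in YC0; rewrite YC0 in nY.
      rewrite (big_setD1 C0) /=; last by rewrite in_setD nYC0.
      by rewrite eqxx big1 ?mulr1 // => C; rewrite in_setD1 => /andP[/negPf-> _].
    rewrite /a !prodh // mulrACA -signr_addb -[RHS]mulN1r; congr (_ * _).
    by rewrite -/X'; move: XX'; case: (C0 \in X); case: (C0 \in X').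
  by rewrite big1 // => A _; rewrite M0 ?scaler0.
apply/matrixP=> i j; rewrite [RHS]mxE.
have /matrixP/(_ i 0) := delta (enum_val j); rewrite !mxE (bigD1 j) //= mxE eqxx mulr1 big1 ?addr0 //.
by move=> k k'j; rewrite mxE (inj_eq enum_val_inj) (negPf k'j) mulr0.
Qed.

Lemma lee_mx_sq : lee_mx D *m lee_mx D = 0.
Proof.
by apply: coloring_forms_separate => S s sS; rewrite -mulmxA lee_sq_form.
Qed.

End Square.

(** * A Lee cycle on the oriented state *)

Section SeifertCycle.
Variables (n : nat) (D : diagram n).
Implicit Types (S : {set 'I_n}) (c : 'I_n) (d x y : dart n) (s : dart n -> bool).
Implicit Types (X Y : {set {set dart n}}) (e : enhanced_state D).
Local Notation seif := (seifert D).
Local Notation color := (seifert_color D).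

Definition positively_linked : rel {set dart n} :=
  linked (circle_joins D seif) (~: seif).

Definition odd_ones X : bool :=
  [forall v in circles D seif, odd #|[set w in circles D seif :\: X | positively_linked v w]|].

(** Reversing all colours in a class multiplies a coefficient by -1 for each circle labelled 1
    there. The difference of Lee's two generators therefore keeps the terms with an odd number of
    1's, doubled; the powers of 2 are dropped. *)
Definition lee_cycle e : rat := coloring_form seif color e * (odd_ones (val e).2)%:R.

Lemma seifert_compatible : compatible D seif color.
Proof. by apply/compatibleP; split; [apply: seifert_color_arc | apply: seifert_color_partner]. Qed.

Lemma seifert_color_02 c : color (crossing_dart c 2%:R) = ~~ color (crossing_dart c 0).
Proof. by rewrite -[2%:R]add0r seifert_color_opp. Qed.

Lemma seifert_form_boundary : lee_mx D *m covector (coloring_form seif color) = 0.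
Proof.
rewrite lee_mx_form ?seifert_compatible // big1 // => c _; rewrite /weight.
have [Sc|] /= := boolP (c \in seif); last by rewrite scale0r.
have fl : flip_at c (seif :\ c) seif.
  by rewrite -{2}(setD1K Sc); apply: flip_at_setU1; rewrite setD11.
rewrite (compatible_flip fl seifert_compatible) seifert_color_02.
by case: (color _); rewrite scale0r.
Qed.

Section Toggle.
Variables (U : {set {set dart n}}) (p q : {set dart n}).
Definition toggle X := [set C | (C == p) (+) (C \in X)].

Lemma odd_toggle (R : pred {set dart n}) X : p \in U ->
  odd #|[set w in U :\: toggle X | R w]| = R p (+) odd #|[set w in U :\: X | R w]|.
Proof.
move=> Up; have E Y : #|[set w in U :\: Y | R w]|
    = (((p \notin Y) && R p) + #|[set w in (U :\ p) :\: Y | R w]|)%N.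
  rewrite (cardsD1 p) !inE Up andbT; congr (_ + _)%N; apply: eq_card => w; rewrite !inE.
  by case: (w == p); rewrite //= !andbF.
rewrite !E !oddD !inE eqxx addTb negbK.
have -> : [set w in (U :\ p) :\: toggle X | R w] = [set w in (U :\ p) :\: X | R w].
  by apply/setP=> w; rewrite !inE; case: (w == p); rewrite //= !andbF.
by case: (p \in X); case: (R p); case: (odd #|[set w in _ | _]|).
Qed.

Lemma prod_toggle (g : {set dart n} -> rat) X : p \in U -> g p * g p = 1 ->
  \prod_(C in U :\: toggle X) g C = g p * \prod_(C in U :\: X) g C.
Proof.
move=> Up gp; have E Y : \prod_(C in U :\: Y) g C
    = (if p \in Y then 1 else g p) * \prod_(C in (U :\ p) :\: Y) g C.
  have [Yp|nYp] := boolP (p \in Y).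
    rewrite mul1r; apply: eq_bigl => C; rewrite !inE; case: eqP => //= ->.
    by rewrite Yp.
  rewrite (big_setD1 p) /= ?inE ?nYp //; congr (_ * _); apply: eq_bigl => C.
  by rewrite !inE; case: (C == p); rewrite //= !andbF.
rewrite !E mulrA; have -> : \prod_(C in (U :\ p) :\: toggle X) g C = \prod_(C in (U :\ p) :\: X) g C.
  by apply: eq_bigl => C; rewrite !inE; case: (C == p); rewrite //= !andbF.
by rewrite inE eqxx addTb; case: (p \in X); rewrite /= ?mulr1 ?gp.
Qed.

End Toggle.

(** Changing the labels of both circles at [c] preserves the parity in every class, and reverses the
    sign of the term because sigma differs on the two circles while [s] agrees. *)
Lemma lee_cycle_form s c : c \notin seif -> compatible D seif s ->
  compatible D (c |: seif) s -> \sum_e lee_cycle e * coloring_form seif s e = 0.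
Proof.
move=> nc ss sc; pose p := circle_end0 D seif c; pose q := circle_end2 D seif c.
have s02 : s (crossing_dart c 0) = s (crossing_dart c 2%:R).
  by apply/eqP; rewrite -(compatible_flip (flip_at_setU1 nc) sc).
have pS : p \in circles D seif by apply: circle_in.
have qS : q \in circles D seif by apply: circle_in.
have p'q : p != q by apply: separates_seifert.
have Lpq : positively_linked p q by apply: (linked_ends (circle_joinsE D seif)); rewrite in_setC.
pose t X := toggle p (toggle q X).
have tE X C : (C \in t X) = (C == p) (+) ((C == q) (+) (C \in X)) by rewrite !inE.
have tK : involutive t.
  move=> X; apply/setP=> C; rewrite !tE; by case: (C == p); case: (C == q); rewrite ?addFb ?addTb ?negbK.
have t_sub X : X \subset circles D seif -> t X \subset circles D seif.
  move=> sX; apply/subsetP=> C; rewrite tE; case: eqP => [->//|_]; case: eqP => [->//|_].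
  exact: subsetP.
have odd_t X : odd_ones (t X) = odd_ones X.
  apply: eq_forallb => v; congr (_ ==> _); rewrite !odd_toggle // addbA.
  suff -> : positively_linked v p = positively_linked v q by rewrite addbb.
  apply/idP/idP => /linked_trans; apply=> //.
  by rewrite (linked_sym (circle_joinsE D seif)).
pose h e : enhanced_state D :=
  if (val e).1 == seif then insubd e (seif, t (val e).2) else e.
have valh e : (val e).1 = seif -> val (h e) = (seif, t (val e).2).
  move=> De; rewrite /h De eqxx insubdK // -topredE /= t_sub //.
  by have := valP e; rewrite /= De.
apply: (@sum_anti_involution _ _ h) => e.
  have [De|De] := eqVneq (val e).1 seif; last by rewrite /h (negPf De) (negPf De).
  by apply: val_inj; rewrite valh valh // tK -De -surjective_pairing.
have [De|De] := eqVneq (val e).1 seif; last first.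
  by rewrite /h (negPf De) /lee_cycle /coloring_form (negPf De) !mulr0 oppr0.
rewrite /lee_cycle /coloring_form valh // De !eqxx /= odd_t mulrAC [in RHS]mulrAC -mulNr.
congr (_ * _); set X := (val e).2; rewrite -!big_split /=.
pose g C := circle_sign color C * circle_sign s C.
have gg C : g C * g C = 1 by rewrite /g mulrACA !circle_sign_sqr mulr1.
rewrite -[LHS]/(\prod_(C in circles D seif :\: t X) g C).
rewrite -[in RHS]/(\prod_(C in circles D seif :\: X) g C).
rewrite !prod_toggle // mulrA -mulN1r; congr (_ * _).
rewrite /g /p /q /circle_end0 /circle_end2 !(circle_signE _ ss) !(circle_signE _ seifert_compatible).
by rewrite -s02 seifert_color_02; case: (s _); case: (color _).
Qed.

Definition lee_cycle_row : 'rV[rat]_#|enhanced_state D| := \row_a lee_cycle (enum_val a).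

Lemma lee_cycle_closed : lee_cycle_row *m lee_mx D = 0.
Proof.
apply: coloring_forms_separate => S s sS; rewrite -mulmxA lee_mx_form // mulmx_sumr big1 // => c _.
rewrite -scalemxAr row_covector /weight; have [/andP[Sc sSc]|_] := boolP (_ && _); last by rewrite scale0r.
have [DS|DS] := eqVneq (S :\ c) seif; last first.
  rewrite big1 => [|e _]; first by rewrite raddf0 scaler0.
  rewrite /lee_cycle /coloring_form; case: eqP => [->|_]; last by rewrite !mul0r.
  by rewrite eq_sym (negPf DS) mulr0.
rewrite DS in sSc *; rewrite (@lee_cycle_form s c) ?raddf0 ?scaler0 //.
  by rewrite -DS setD11.
by rewrite -DS setD1K.
Qed.

(** Label one representative of each class with 1 and all other circles with x. *)
Lemma odd_ones_exists : exists e, ((val e).1 == seif) && odd_ones (val e).2.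
Proof.
pose r := fingraph.root [rel u v | [exists c in ~: seif, circle_joins D seif c u v]].
pose X := [set v in circles D seif | r v != v].
have sX : (seif, X).2 \subset circles D (seif, X).1 by apply/subsetP=> v; rewrite inE => /andP[].
exists (Sub (seif, X) sX : enhanced_state D); rewrite SubK eqxx /=.
apply/forallP=> v; apply/implyP=> Sv.
have sym : connect_sym [rel u v | [exists c in ~: seif, circle_joins D seif c u v]].
  by move=> u w; apply: (linked_sym (circle_joinsE D seif)).
have Srv : r v \in circles D seif.
  apply: (linked_preserves (circle_joinsE D seif) (P := mem (circles D seif)) _ (connect_root _ v) Sv) => c _ /=.
  by rewrite !circle_in.
suff -> : [set w in circles D seif :\: X | positively_linked v w] = [set r v] by rewrite cards1.
apply/setP=> w; rewrite !inE negb_and negbK; apply/idP/eqP => [|->].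
  case/andP=> /andP[h Sw]; rewrite Sw /= in h.
  by rewrite /positively_linked /linked -(root_connect sym) -/r (eqP h) => /eqP.
by rewrite Srv /r (root_root sym) eqxx /=; apply: connect_root.
Qed.

Lemma lee_cycle_not_boundary : ~~ (lee_cycle_row <= lee_mx D)%MS.
Proof.
apply/negP=> /submxP[y Dz].
have : lee_cycle_row *m covector (coloring_form seif color) = 0.
  by rewrite Dz -mulmxA seifert_form_boundary mulmx0.
rewrite row_covector => /matrixP/(_ 0 0); rewrite !mxE mulr1n => /eqP.
(* The coefficients of Lee's generator equal the values of its functional, so the pairing is a sum
   of squares over the states with odd counts. *)
have term_ge0 e : 0 <= lee_cycle e * coloring_form seif color e.
  by rewrite /lee_cycle mulrAC mulr_ge0 // ?ler0n // -expr2 sqr_ge0.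
rewrite psumr_eq0 // => /allP all0; have [e /andP[De oe]] := odd_ones_exists.
have := all0 e (mem_index_enum e); rewrite /lee_cycle /coloring_form De oe mulr1 /=.
rewrite -big_split /= big1 ?oner_eq0 // => C _; exact: circle_sign_sqr.
Qed.

Lemma lee_cycle_support e : lee_cycle e != 0 -> (val e).1 = seif /\ odd_ones (val e).2.
Proof.
rewrite /lee_cycle /coloring_form.
have [->|_] := eqVneq (val e).1 seif; last by rewrite mul0r eqxx.
by case: (odd_ones _); rewrite ?mulr0 ?eqxx.
Qed.

(* Each class of positively linked circles contributes at least one circle
   labelled [1] to the cycle and at most one to [X]. *)
Lemma lee_cycle_grading X e : X \subset circles D seif ->
  {in circles D seif :\: X &, forall v v', positively_linked v v' -> v = v'} ->
  lee_cycle e != 0 -> j_grading D seif X <= j_state e.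
Proof.
move=> sX uniqX /lee_cycle_support[De odd_e]; rewrite /j_state De.
have sY : (val e).2 \subset circles D seif by rewrite -De; exact: valP e.
set Y := (val e).2 in sY odd_e *.
(* A circle labelled 1 in the class of [v]; an odd number is not zero, so the default is not reached
   for a circle [v]. Uniqueness in each class makes [f] injective outside [X]. *)
pose f v := odflt v [pick w in circles D seif :\: Y | positively_linked v w].
have fP v : v \in circles D seif -> f v \in circles D seif :\: Y /\ positively_linked v (f v).
  move=> Sv; rewrite /f; case: pickP => [w /andP[]//|no_w].
  have := forallP odd_e v; rewrite Sv /= (_ : [set w in _ | _] = set0) ?cards0 //.
  by apply/setP=> w; rewrite !inE; have := no_w w; rewrite !inE.
have leXY : (#|circles D seif :\: X| <= #|circles D seif :\: Y|)%N.
  rewrite -(card_in_imset (f := f)) => [|v v' Xv Xv' Dfv].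
    apply/subset_leq_card/subsetP=> _ /imsetP[v /setDP[Sv _] ->]; exact: (fP v Sv).1.
  apply: uniqX => //; have [/setDP[Sv _] /setDP[Sv' _]] := (Xv, Xv').
  have [_ Lv] := fP v Sv; have [_ Lv'] := fP v' Sv'.
  by apply: linked_trans Lv _; rewrite Dfv (linked_sym (circle_joinsE D seif)).
have := cardsID X (circles D seif); have := cardsID Y (circles D seif).
rewrite !(setIidPr _) // /j_grading => cY cX.
move: #|circles D seif :\: X| #|circles D seif :\: Y| #|X| #|Y| leXY cX cY => a b k m; lia.
Qed.

End SeifertCycle.

(** * Filtration degrees of surviving classes *)

Lemma le_last_flatten_nseq (m : int -> nat) (s : seq int) (x0 x : int) :
  sorted <=%R s -> x \in flatten [seq nseq (m j) j | j <- s] ->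
  x <= last x0 (flatten [seq nseq (m j) j | j <- s]).
Proof.
elim: s x0 => //= j s IHs x0 js; have s_sorted := path_sorted js.
rewrite mem_cat last_cat mem_nseq => /orP[/andP[mj /eqP->]|]; last exact: IHs.
have Dl : last x0 (nseq (m j) j) = j.
  by rewrite (last_nth j) size_nseq; case: (m j) mj => //= k _; elim: k.
rewrite Dl; case E: (flatten _) => [|y t] //=.
have := mem_last y t; rewrite -E => /flatten_mapP[j' sj' /nseqP[-> _]].
have := order_path_min le_trans js => /allP; exact.
Qed.

Section Spectral.
Variables (n : nat) (D : diagram n).
Local Notation F := (lee_filtration D).
Local Notation Z := (kermx (lee_mx D)).

Lemma row_filtration (v : 'rV_#|enhanced_state D|) j :
  (forall a, v 0 a != 0 -> j <= j_state (enum_val a)) -> (v <= F j)%MS.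
Proof.
move=> vj; suff -> : v = v *m F j by apply: submxMl.
apply/rowP=> a; rewrite /lee_filtration mul_mx_diag !mxE.
by have [->|/vj->] := eqVneq (v 0 a) 0; rewrite ?mul0r ?mulr1.
Qed.

Lemma filtration_le j k : k <= j -> (F j <= F k)%MS.
Proof.
move=> le_kj; apply/row_subP=> b; apply: row_filtration => a.
rewrite !mxE; have [->|_] := eqVneq b a; rewrite ?mulr0n ?eqxx // mulr1n.
by case: (boolP (j <= _)) => [/(le_trans le_kj)|]; rewrite ?eqxx.
Qed.

(** A zero truncated difference gives only an inequality of ranks. Since boundaries are cycles, the
    second space lies in the first, and the two are equal. *)
Lemma Einf_dim0_sub j : lee_Einf_dim D j = 0%N ->
  (Z :&: F j <= (Z :&: F (j + 1)) + (lee_mx D :&: F j))%MS.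
Proof.
move=> /eqP; rewrite subn_eq0 => le_rank.
have BZ : (lee_mx D <= Z)%MS by apply/sub_kermxP/lee_mx_sq.
have sub : ((Z :&: F (j + 1)) + (lee_mx D :&: F j) <= Z :&: F j)%MS.
  by rewrite addsmx_sub !capmxS // filtration_le // lerDl.
by rewrite -(mxrank_leqif_sup sub) eqn_leq le_rank mxrankS.
Qed.

(** If no degree from [j] on survived, [z] could be moved modulo boundaries into ever higher
    filtration steps, which are eventually zero, and would be a boundary. *)
Lemma surviving_above (z : 'rV_#|enhanced_state D|) j :
  z *m lee_mx D = 0 -> ~~ (z <= lee_mx D)%MS -> (z <= F j)%MS ->
  exists2 j', j <= j' & j' \in surviving_gradings D.
Proof.
move=> /sub_kermxP zZ znB zF.
pose none := ~~ has (fun j' => j <= j') (surviving_gradings D).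
have [none_above|] := boolP none; last by rewrite negbK => /hasP[j' ? ?]; exists j'.
have F_step k : j <= k -> (Z :&: F k <= (Z :&: F (k + 1)) + (lee_mx D :&: F k))%MS.
  move=> le_jk; have [e De|no_e] := pickP (fun e : enhanced_state D => j_state e == k).
    apply: Einf_dim0_sub; apply/eqP; apply: contraR none_above; rewrite -lt0n => dim_gt0.
    apply/hasP; exists k => //; apply/flatten_mapP; exists k.
      by rewrite mem_sort mem_undup; apply/mapP; exists e; rewrite ?mem_enum ?(eqP De).
    by rewrite mem_nseq dim_gt0 eqxx.
  suff -> : F k = F (k + 1) by apply: addsmxSl.
  congr diag_mx; apply/rowP=> a; rewrite !mxE; congr (nat_of_bool _)%:R.
  by rewrite lezD1 lt_neqAle eq_sym no_e.
have z_step m : (z <= (Z :&: F (j + m%:Z)) + lee_mx D)%MS.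
  elim: m => [|m IHm]; first by rewrite addr0 (submx_trans _ (addsmxSl _ _)) // sub_capmx zZ.
  apply: submx_trans IHm _; rewrite addsmx_sub addsmxSr andbT.
  have le_jm : j <= j + m%:Z by rewrite lerDl.
  apply: submx_trans (F_step _ le_jm) _; rewrite -addrA -[m.+1]addn1 PoszD.
  by rewrite addsmxS // capmxSl.
(* Larger than every distance between [j] and the degree of a state, so that nothing is left in
   filtration step [j + m]. *)
pose m := (\sum_(e : enhanced_state D) `|j_state e - j|).+1%N.
have F0 : F (j + m%:Z) = 0.
  apply/matrixP=> a b; rewrite !mxE; set e := enum_val a.
  suff -> : (j + m%:Z <= j_state e) = false by rewrite mul0rn.
  have : (`|j_state e - j| <= \sum_(e : enhanced_state D) `|j_state e - j|)%N.
    by rewrite (bigD1 e) //= leq_addr.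
  rewrite /m; move: (\sum_e _)%N => M; lia.
case/negP: znB; apply: submx_trans (z_step m) _.
by rewrite F0 capmx0 adds0mx.
Qed.

Lemma surviving_le_s_max j : j \in surviving_gradings D -> j <= s_max D.
Proof. by apply: le_last_flatten_nseq; apply: sort_sorted; apply: le_total. Qed.

End Spectral.

Theorem corollary1p5 (n : nat) (D : diagram n) (T : {set 'I_n}) (le : rel 'I_n)
    (D_knot : is_knot D)
    (T_pres : orientation_preserving_tree D T)
    (le_pres : orientation_preserving_order D T le) :
  j_plus D T le - 1 <= s_invariant D.
Proof.
rewrite lerB // (j_plusE T_pres le_pres).
have [|j' le_j sj'] := surviving_above (lee_cycle_closed D) (lee_cycle_not_boundary D)
    (j := j_grading D (seifert D) (eps_c_x D T le)); last first.
  exact: le_trans le_j (surviving_le_s_max sj').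
apply: row_filtration => a; rewrite mxE; apply: lee_cycle_grading.
  exact (eps_c_x_sub T_pres le_pres).
move=> v v' /setDP[Sv Xv] /setDP[Sv' Xv'] Lvv'.
exact: (eps_c_x_class T_pres le_pres).
Qed.
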